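(* Let $G$ be a finite simple connected graph with $c(G)+q(G)=2$ and $c(G)\ge 1$, and let $\lambda\neq 1$ be a real number. Then $G$ is $\lambda$-optimal, i.e. $m_G(\lambda)=2c(G)+q(G)-1$, if and only if one of the following holds: (1) $G=F_{uw}(C,K_{1,k};P_l)$ for some cycle $C$ with a vertex $u$ of $C$, some star $K_{1,k}$ ($k\ge 1$) with center $w$, and some integer $l>1$, such that $m_{C}(\lambda)=2$ and $m_{T(k,l-1)}(\lambda)=1$; (2) $G=F_{uw}(C_{g_1},C_{g_2};P_l)$ for some cycles $C_{g_1},C_{g_2}$ with vertices $u\in V(C_{g_1})$, $w\in V(C_{g_2})$, and some integer $l>1$, such that $m_{C_{g_1}}(\lambda)=m_{C_{g_2}}(\lambda)=2$ and, when $l>2$, also $m_{P_{l-2}}(\lambda)=1$.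
   Context: All graphs are finite and simple. For a graph $G$, $L(G)=D(G)-A(G)$ is the Laplacian matrix, and $m_G(\lambda)$ is the multiplicity of $\lambda$ as an eigenvalue of $L(G)$ (equal to $0$ if $\lambda$ is not an eigenvalue). A pendant vertex is a vertex of degree $1$; a quasi-pendant vertex is a vertex adjacent to a pendant vertex; $q(G)$ is the number of quasi-pendant vertices of $G$. For connected $G$, $c(G)=|E(G)|-|V(G)|+1$. $G$ is called $\lambda$-optimal if $m_G(\lambda)=2c(G)+q(G)-1$. $C_g$ is the cycle and $P_l$ the path on $g$, resp. $l$, vertices. For disjoint graphs $G,H$ with $u\in V(G)$, $v\in V(H)$ and a path $P_l: w_1w_2\cdots w_l$ ($l\ge 1$), $F_{uv}(G,H;P_l)$ is the graph obtained by identifying $u$ with $w_1$ and $v$ with $w_l$ (if $l=1$, $u$ and $v$ are identified with each other). For $k,l\ge 1$, $T(k,l)$ is the tree on $k+l$ vertices obtained from the star $K_{1,k}$ by identifying its center with an end vertex of $P_l$; in particular $T(k,1)=K_{1,k}$. *)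

(* Defs.v *)
From HB Require Import structures.
From mathcomp Require Import all_boot all_order all_algebra.
From mathcomp Require Import reals.
Set Implicit Arguments.
Unset Strict Implicit.
Unset Printing Implicit Defensive.
Import Order.TTheory GRing.Theory Num.Theory.
Local Open Scope ring_scope.

Record sgraph := SGraph {
  vertex :> finType;
  adj : rel vertex;
  adj_sym : symmetric adj;
  adj_irr : irreflexive adj }.

Definition isomorphic (G H : sgraph) : Prop :=
  exists2 f : G -> H, bijective f & {mono f : x y / adj x y}.

Definition connected (G : sgraph) : Prop :=
  (0 < #|G|)%N /\ forall x y : G, connect (@adj G) x y.

Definition deg (G : sgraph) (x : G) : nat := #|[set y | adj x y]|.

Definition pendant (G : sgraph) (x : G) : bool := deg x == 1%N.

Definition quasi_pendant (G : sgraph) (x : G) : bool :=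
  [exists y, adj x y && pendant y].

Definition num_quasi_pendant (G : sgraph) : nat := #|[set x : G | quasi_pendant x]|.

Definition edges (G : sgraph) : {set {set G}} :=
  [set [set p.1; p.2] | p in [pred p : G * G | adj p.1 p.2]].

(* Valued in int, so that the subtraction is not truncated. *)
Definition cyclomatic (G : sgraph) : int := #|edges G|%:Z - #|G|%:Z + 1.

Section Laplacian.
Variables (R : realType) (G : sgraph).

(* Rows and columns are indexed by the enumeration of the vertices of G. *)
Definition degree_mx : 'M[R]_#|G| := diag_mx (\row_i (deg (enum_val i))%:R).

Definition adjacency_mx : 'M[R]_#|G| :=
  \matrix_(i, j) (adj (enum_val i) (enum_val j))%:R.

Definition laplacian : 'M[R]_#|G| := degree_mx - adjacency_mx.

(* The Laplacian is real symmetric, so the dimension of the eigenspace is also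
   the multiplicity of lambda as a root of the characteristic polynomial. *)
Definition mult (lambda : R) : nat := \rank (eigenspace laplacian lambda).

Definition optimal (lambda : R) : Prop :=
  (mult lambda)%:Z = 2 * cyclomatic G + (num_quasi_pendant G)%:Z - 1.

End Laplacian.

Definition path_rel l : rel 'I_l :=
  fun i j => (j == i.+1 :> nat) || (i == j.+1 :> nat).

Fact path_rel_sym l : symmetric (@path_rel l).
Proof. by move=> i j; rewrite /path_rel orbC. Qed.

Fact path_rel_irr l : irreflexive (@path_rel l).
Proof. by move=> i; rewrite /path_rel orbb ltn_eqF. Qed.

Definition path_graph l : sgraph := SGraph (@path_rel_sym l) (@path_rel_irr l).

(* This is the cycle on g vertices only for g >= 3. *)
Definition cycle_rel g : rel 'I_g :=
  fun i j => (i != j) && ((j == ordS i) || (i == ordS j)).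

Fact cycle_rel_sym g : symmetric (@cycle_rel g).
Proof. by move=> i j; rewrite /cycle_rel orbC eq_sym. Qed.

Fact cycle_rel_irr g : irreflexive (@cycle_rel g).
Proof. by move=> i; rewrite /cycle_rel eqxx. Qed.

Definition cycle_graph g : sgraph :=
  SGraph (@cycle_rel_sym g) (@cycle_rel_irr g).

(* The star K_{1,k}: the center is None, the leaves are the Some i. *)
Definition star_rel k : rel (option 'I_k) := fun x y => isSome x != isSome y.

Fact star_rel_sym k : symmetric (@star_rel k).
Proof. by move=> x y; rewrite /star_rel eq_sym. Qed.

Fact star_rel_irr k : irreflexive (@star_rel k).
Proof. by move=> x; rewrite /star_rel eqxx. Qed.

Definition star_graph k : sgraph := SGraph (@star_rel_sym k) (@star_rel_irr k).

Definition star_center k : star_graph k := None.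

(* Disjoint union of G and H with u and v identified: the merged vertex is
   represented by inl u. *)
Section Glue.
Variables (G : sgraph) (u : G) (H : sgraph) (v : H).

Definition glue_vertex : finType := (G + {y : H | y != v})%type.

Definition glue_rel : rel glue_vertex := fun a b =>
  match a, b with
  | inl x, inl x' => adj x x'
  | inl x, inr y => (x == u) && adj v (val y)
  | inr y, inl x => (x == u) && adj v (val y)
  | inr y, inr y' => adj (val y) (val y')
  end.

Fact glue_rel_sym : symmetric glue_rel.
Proof. by move=> [x|y] [x'|y'] //=; rewrite adj_sym. Qed.

Fact glue_rel_irr : irreflexive glue_rel.
Proof. by move=> [x|y] /=; rewrite adj_irr. Qed.

Definition glue : sgraph := SGraph glue_rel_sym glue_rel_irr.

(* The vertex of glue coming from a vertex of H. *)
Definition glue_inr (y : H) : glue :=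
  if insub y is Some y' then inr y' else inl u.

End Glue.

(* The graph F_{uv}(G,H;P_l), for l >= 1. The path is written path_graph l.-1.+1, which is
   path_graph l for l >= 1, so that its end vertices ord0 and ord_max exist. *)
Definition path_join (G : sgraph) (u : G) (H : sgraph) (v : H) (l : nat) : sgraph :=
  @glue (@glue G u (path_graph l.-1.+1) ord0)
        (@glue_inr G u (path_graph l.-1.+1) ord0 ord_max) H v.

(* The tree T(k,l), for k, l >= 1. *)
Definition star_path_tree (k l : nat) : sgraph :=
  @glue (star_graph k) (star_center k) (path_graph l.-1.+1) ord0.

(* Main.v *)
(* Eigenfunctions of the Laplacian obey a second-order linear recurrence along every path
   of degree-2 vertices, so in each of the graphs below they are determined by their
   values at 2c + q - 1 well-chosen vertices; G is optimal exactly when these values can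
   be prescribed freely.  On a cycle attached at one vertex, freeness forces the
   recurrence to have trivial monodromy around the cycle, i.e. multiplicity 2 for the
   cycle.  The cycle then contributes nothing to the equation at its root, so the
   eigenfunction is constant on the first edge of the connecting path, and what remains
   is the eigenvalue equation of T(k,l-1), resp. P_(l-2).  A connecting path with l = 1,
   or a theta graph, would force lambda = 0, which trivial monodromy excludes.

   The shape of G is found by following the paths of degree-2 vertices between the
   remaining vertices.  These paths pair the darts leaving the remaining vertices by a
   fixed-point-free involution, so few cases occur.  The isomorphism with the model graph
   is obtained from a covering map, all of whose fibres have the same size; no
   disjointness of the paths has to be checked beyond one singleton fibre. *)

Require Import Defs.
From HB Require Import structures.
From mathcomp Require Import all_boot all_order all_algebra.
From mathcomp Require Import reals.
From mathcomp Require Import ring lra zify.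
Set Implicit Arguments.
Unset Strict Implicit.
Unset Printing Implicit Defensive.
Import Order.TTheory GRing.Theory Num.Theory.
Local Open Scope ring_scope.

(** * Sums over neighbours in glued graphs *)

(** The hypotheses leave c = q = 1 and c = 2, q = 0, with target multiplicities 2 and 3. No spectrum
    is computed: restriction to a determining sequence [D] embeds the eigenspace in R^|D|, so the
    multiplicity is |D| exactly when the restriction is onto. Surjectivity is exploited only through
    two or three prescribed eigenfunctions. One that is 0 at the root of a cycle and 1 next to it,
    together with one that is nonzero at the root, already forces the transfer matrix round the
    cycle to be the identity. For lambda = 0 the recurrence has the solution Y i = i, which never
    returns to 0; this is why trivial monodromy excludes lambda = 0. The value at a leaf is
    determined by its neighbour because lambda is not 1. In the classification, c + q = 2 fixes the
    sum of all degrees, which leaves few vertices where paths can branch. *)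

Definition nsum (V : nmodType) (G : sgraph) (x : G) (F : G -> V) : V :=
  \sum_(y | adj x y) F y.

Lemma eq_nsum (V : nmodType) (G : sgraph) (x : G) (F F' : G -> V) :
  F =1 F' -> nsum x F = nsum x F'.
Proof. by move=> eqF; apply: eq_bigr => y _; rewrite eqF. Qed.

Lemma deg_nsum (G : sgraph) (x : G) : deg x = nsum x (fun=> 1%N).
Proof. by rewrite /nsum /deg -sum1dep_card. Qed.

Section GlueSum.
Variables (G : sgraph) (u : G) (H : sgraph) (v : H).
Local Notation K := (glue u v).
Local Notation inH := (@glue_inr G u H v).

Definition glue_inl (x : G) : K := inl x.

Lemma glue_inr_root : inH v = glue_inl u.
Proof. by rewrite /glue_inr insubF ?eqxx. Qed.

Lemma glue_inr_val (y : {y : H | y != v}) : inH (val y) = inr y.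
Proof. by rewrite /glue_inr valK. Qed.

Lemma glue_vertexP (z : K) :
  (exists x, z = glue_inl x) \/ (exists2 y, y != v & z = inH y).
Proof.
case: z => [x|y]; first by left; exists x.
by right; exists (val y); rewrite ?(valP y) ?glue_inr_val.
Qed.

Lemma glue_rec (T : Type) (f : G -> T) (h : H -> T) : f u = h v ->
  exists F : K -> T, (forall x, F (glue_inl x) = f x) /\ forall y, F (inH y) = h y.
Proof.
move=> fu; exists (fun z : K => match z with inl x => f x | inr y => h (val y) end).
split=> // y; rewrite /glue_inr; case: insubP => [z _ -> //|].
by rewrite negbK => /eqP->.
Qed.

Lemma sum_unroot (V : nmodType) (P : pred H) (F : H -> V) :
  \sum_(y : {y : H | y != v} | P (val y)) F (val y) = \sum_(y | P y && (y != v)) F y.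
Proof.
rewrite [RHS](reindex_omap (val : {y : H | y != v} -> H) insub); last first.
  by move=> y /andP[_ yv]; case: insubP => [z _ /= ->//|]; rewrite yv.
by apply: eq_bigl => y; rewrite valK eqxx andbT (valP y) andbT.
Qed.

(** Values in any [nmodType] let the same formulas serve Laplacians over [R], and degrees and fibre
    counts in [nat]. *)
Lemma nsum_glue (V : nmodType) (z : K) (F : K -> V) :
  nsum z F = match z with
    | inl x => nsum x (F \o glue_inl) + (if x == u then nsum v (F \o inH) else 0)
    | inr y => nsum (val y) (F \o inH) end.
Proof.
rewrite /nsum big_sumType /=; case: z => [x|y] /=.
  congr (_ + _); case: eqP => _; last by rewrite big_pred0.
  rewrite (bigID (pred1 v)) /= [X in _ = X + _]big_pred0 ?add0r; last first.
    by move=> y; case: eqP => [->|]; rewrite ?adj_irr ?andbF.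
  rewrite -sum_unroot; apply: eq_bigr => y _.
  by rewrite -glue_inr_val.
have vy := valP y.
rewrite [RHS](bigID (pred1 v)) /= -sum_unroot; congr (_ + _).
  (* The root is [inl u] in the glued graph and [v] in [H]; its term is compared separately from the
     others. *)
  case: (boolP (adj (val y) v)) => a.
    rewrite [RHS](big_pred1 v) => [|w /=]; last by case: eqP => [->|]; rewrite ?a ?andbF.
    rewrite (big_pred1 u) ?glue_inr_root // => w /=.
    by rewrite [adj v _]adj_sym a andbT.
  rewrite !big_pred0 // => w.
    by case: eqP => [->|]; rewrite ?(negPf a) ?andbF.
  by rewrite [adj v _]adj_sym (negPf a) andbF.
by apply: eq_bigr => w _; rewrite -glue_inr_val.
Qed.

Lemma nsum_glue_inl (V : nmodType) x (F : K -> V) : x != u ->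
  nsum (glue_inl x) F = nsum x (F \o glue_inl).
Proof. by move=> xu; rewrite nsum_glue /= (negPf xu) addr0. Qed.

Lemma nsum_glue_root (V : nmodType) (F : K -> V) :
  nsum (glue_inl u) F = nsum u (F \o glue_inl) + nsum v (F \o inH).
Proof. by rewrite nsum_glue /= eqxx. Qed.

Lemma nsum_glue_inr (V : nmodType) y (F : K -> V) : y != v ->
  nsum (inH y) F = nsum y (F \o inH).
Proof.
by move=> yv; rewrite -[y]/(val (exist (fun y => y != v) y yv)) glue_inr_val nsum_glue.
Qed.

End GlueSum.

Lemma nsum_path (V : nmodType) n (i : path_graph n.+1) (F : path_graph n.+1 -> V) :
  nsum i F = (if (0 < i)%N then F (inord i.-1) else 0)
           + (if (i < n)%N then F (inord i.+1) else 0).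
Proof.
have ilt : (i < n.+1)%N := ltn_ord i.
rewrite /nsum (bigID (fun j : path_graph n.+1 => (j < i)%N)) /=; congr (_ + _).
  case: ifP => i0; last by apply: big_pred0 => j; rewrite /path_rel; lia.
  apply: big_pred1 => j /=; rewrite /path_rel.
  have -> : (j == inord i.-1) = (j == i.-1 :> nat) by rewrite -val_eqE /= inordK //; lia.
  lia.
case: ifP => i0; last first.
  apply: big_pred0 => j; rewrite /path_rel; have jlt : (j < n.+1)%N := ltn_ord j; lia.
apply: big_pred1 => j /=; rewrite /path_rel.
have -> : (j == inord i.+1) = (j == i.+1 :> nat) by rewrite -val_eqE /= inordK //; lia.
lia.
Qed.

Lemma nsum_cycle (V : nmodType) g (i : cycle_graph g) (F : cycle_graph g -> V) :
  (3 <= g)%N -> nsum i F = F (ordS i) + F (ord_pred i).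
Proof.
move=> g3; have neq : ordS i != ord_pred i.
  rewrite -(inj_eq (bij_inj (@ordS_bij g))) ord_predK -val_eqE /=.
  case: i => i /= ig; case: (ltngtP i.+1 g) => h; [|lia|].
    rewrite (modn_small h); case: (ltngtP i.+2 g) => h2; [|lia|].
      by rewrite modn_small //; lia.
    by rewrite h2 modnn; lia.
  by rewrite h modnn modn_small; lia.
have neqS : ordS i != i.
  rewrite -val_eqE /=.
  case: i {neq} => i /= ig; case: (ltngtP i.+1 g) => h; [|lia|].
    by rewrite (modn_small h); lia.
  by rewrite h modnn; lia.
rewrite /nsum (bigD1 (ordS i)) /=; last first.
  by rewrite /cycle_rel eq_sym neqS eqxx.
congr (_ + _); apply: big_pred1 => j.
rewrite /cycle_rel -[in i == ordS j](ord_predK i) (inj_eq (bij_inj (@ordS_bij g))).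
rewrite (eq_sym i j) [ord_pred i == j]eq_sym.
case: (eqVneq j (ord_pred i)) => [->|nj].
  rewrite /= eqxx orbT andbT [ord_pred i == ordS i]eq_sym neq andbT.
  by rewrite -(inj_eq (bij_inj (@ordS_bij g))) ord_predK eq_sym neqS.
by rewrite /= (negPf nj) orbF; case: (j == ordS i); rewrite ?andbF.
Qed.

Lemma nsum_star_center (V : nmodType) k (F : star_graph k -> V) :
  nsum (star_center k) F = \sum_(i < k) F (Some i).
Proof.
rewrite /nsum (reindex_omap Some id); last by case.
by apply: eq_bigl => i; rewrite /= eqxx.
Qed.

Lemma nsum_star_leaf (V : nmodType) k (i : 'I_k) (F : star_graph k -> V) :
  nsum (Some i : star_graph k) F = F (star_center k).
Proof. by apply: big_pred1; case. Qed.

(* [pjA], [pjP], [pjB] embed the three pieces; [pjP i] is the vertex w_(i+1). *)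
Section PathJoin.
Variables (A : sgraph) (u : A) (B : sgraph) (v : B) (n : nat).
Local Notation K := (path_join u v n.+1).
Local Notation inP := (@glue_inr A u (path_graph n.+1) ord0).

Definition pjA (a : A) : K := glue_inl _ _ (glue_inl u _ a).
Definition pjP (i : nat) : K := glue_inl _ _ (inP (inord i)).
Definition pjB (b : B) : K := glue_inr (inP ord_max) v b.

Lemma pjA_root : pjA u = pjP 0.
Proof.
rewrite /pjA /pjP -(glue_inr_root u (ord0 : path_graph n.+1)); congr (glue_inl _ _ (inP _)).
by apply: val_inj; rewrite /= inordK.
Qed.

Lemma pjB_root : pjB v = pjP n.
Proof.
rewrite /pjB glue_inr_root /pjP; congr (glue_inl _ _ (inP _)).
by apply: val_inj; rewrite /= inordK.
Qed.

Lemma inP_inj : injective inP.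
Proof.
move=> i j; rewrite /glue_inr; case: insubP => [a _ ai|]; case: insubP => [b _ bj|] //.
- by move=> [ab]; rewrite -ai -bj ab.
- by rewrite !negbK => /eqP-> /eqP->.
Qed.

Lemma inord_neq0 i : (0 < i <= n)%N -> inord i != ord0 :> path_graph n.+1.
Proof. by move=> h; rewrite -val_eqE /= inordK; lia. Qed.

Lemma inord_neq_max i : (i < n)%N -> inP (inord i) != inP ord_max.
Proof. by move=> h; rewrite (inj_eq inP_inj) -val_eqE /= inordK; lia. Qed.

Lemma inP_ord0 : inP ord0 = glue_inl u _ u.
Proof. exact: glue_inr_root. Qed.

Lemma glue_inl_neq_max a : a != u -> glue_inl u _ a != inP ord_max.
Proof.
move=> au; rewrite /glue_inr; case: insubP => [//|_].
by apply: contra_neq au => -[].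
Qed.

Lemma path_joinP (z : K) :
  [\/ exists a, z = pjA a, exists2 i, (0 < i < n)%N & z = pjP i | exists b, z = pjB b].
Proof.
have [[x ->]|[b _ ->]] := glue_vertexP z; last by constructor 3; exists b.
have [[a ->]|[i i0 ->]] := glue_vertexP x; first by constructor 1; exists a.
have [->|im] := eqVneq i ord_max.
  by constructor 3; exists v; rewrite /pjB glue_inr_root.
constructor 2; exists i; last by rewrite /pjP inord_val.
by move: i0 im (ltn_ord i); rewrite -!val_eqE /=; lia.
Qed.

(** Serves with real values to build eigenfunctions, and with values in a graph to build the
    covering map. *)
Lemma path_join_rec (T : Type) (f : A -> T) (p : nat -> T) (h : B -> T) :
  f u = p 0%N -> p n = h v ->
  exists F : K -> T, [/\ forall a, F (pjA a) = f a,
    forall i, (i <= n)%N -> F (pjP i) = p i & forall b, F (pjB b) = h b].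
Proof.
move=> fp ph.
have [|F [Fa Fp]] := @glue_rec A u (path_graph n.+1) ord0 T f (p \o @nat_of_ord _).
  by rewrite fp.
have [|X [Xa Xb]] := @glue_rec _ (inP ord_max) B v T F h; first by rewrite Fp.
exists X; split=> [a|i le_in|b]; rewrite ?Xb //.
  by rewrite /pjA Xa Fa.
by rewrite /pjP Xa Fp /= inordK.
Qed.

Variable V : nmodType.
Implicit Type F : K -> V.

Lemma nsum_pjA a F : a != u -> nsum (pjA a) F = nsum a (F \o pjA).
Proof.
by move=> au; rewrite nsum_glue_inl ?glue_inl_neq_max // nsum_glue_inl.
Qed.

Lemma nsum_pjB b F : b != v -> nsum (pjB b) F = nsum b (F \o pjB).
Proof. by move=> bv; rewrite nsum_glue_inr. Qed.

Lemma nsum_pjP i F : (0 < i < n)%N ->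
  nsum (pjP i) F = F (pjP i.-1) + F (pjP i.+1).
Proof.
case/andP=> i0 lt_in; rewrite nsum_glue_inl ?inord_neq_max //.
rewrite nsum_glue_inr ?inord_neq0 //; last by rewrite i0 ltnW.
by rewrite nsum_path /= inordK ?i0 ?lt_in // ltnW.
Qed.

Lemma nsum_pj_ends0 F : n = 0%N ->
  nsum (pjA u) F = nsum u (F \o pjA) + nsum v (F \o pjB).
Proof.
move=> n0.
have max0 : inP ord_max = glue_inl u _ u.
  by rewrite -inP_ord0; congr inP; apply: val_inj; rewrite /= n0.
have -> : pjA u = glue_inl (inP ord_max) v (inP ord_max) by rewrite [in RHS]max0.
rewrite nsum_glue_root; congr (_ + _).
(* The type of [F] mentions [inP ord_max], so [max0] cannot be rewritten under it; the equation is
   proved for an arbitrary [F'] on the inner gluing. *)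
have E (F' : glue u (ord0 : path_graph n.+1) -> V) :
    nsum (inP ord_max) F' = nsum u (F' \o glue_inl u _).
  by rewrite max0 nsum_glue_root nsum_path /=; case: ifP => [|_]; rewrite ?addr0 //; lia.
exact: E.
Qed.

Lemma nsum_pj_left F : (0 < n)%N ->
  nsum (pjA u) F = nsum u (F \o pjA) + F (pjP 1).
Proof.
move=> n0; rewrite nsum_glue_inl; last first.
  rewrite -inP_ord0 (inj_eq inP_inj) -val_eqE /=; lia.
by rewrite nsum_glue_root nsum_path /= n0 add0r.
Qed.

Lemma nsum_pj_right F : (0 < n)%N ->
  nsum (pjB v) F = nsum v (F \o pjB) + F (pjP n.-1).
Proof.
move=> n0; rewrite /pjB glue_inr_root nsum_glue_root addrC; congr (_ + _).
rewrite nsum_glue_inr; last by rewrite -val_eqE /=; lia.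
by rewrite nsum_path /= n0 ltnn addr0.
Qed.

End PathJoin.

(** * Coverings and isomorphisms *)

Section Covering.
Variables (H G : sgraph) (f : H -> G).
(** Counting preimages among the neighbours of [x] says in one equation that [f] is a bijection from
    the neighbourhood of [x] to that of [f x]. *)
Hypothesis coverf : forall x v, nsum x (fun y => (f y == v) : nat) = adj (f x) v.

(* Double counting: the edges of H above an edge v - w of G match the two fibres. *)
Lemma covering_fiber_adj v w : adj v w ->
  (\sum_x (f x == v) = \sum_x (f x == w))%N.
Proof.
move=> vw; pose s v w := (\sum_x (f x == v) * nsum x (fun y => (f y == w) : nat))%N.
have sE a b : adj a b -> s a b = (\sum_x (f x == a))%N.
  move=> ab; apply: eq_bigr => x _; rewrite coverf.
  by case: eqP => // ->; rewrite ab.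
have sE2 a b : s a b = (\sum_x \sum_y (adj x y * ((f x == a) * (f y == b))))%N.
  apply: eq_bigr => x _; rewrite /nsum big_mkcond big_distrr /=.
  by apply: eq_bigr => y _; case: adj; rewrite ?mul1n ?muln0 ?mul0n.
rewrite -(sE v w vw) -(sE w v); last by rewrite adj_sym.
rewrite !sE2 exchange_big /=; apply: eq_bigr => y _; apply: eq_bigr => x _.
by rewrite adj_sym [((f x == v) * _)%N]mulnC.
Qed.

(** Fibre sizes agree along edges of the connected graph [G], so one singleton fibre makes [f]
    bijective; the covering condition then transports adjacency both ways. *)
Lemma covering_iso b : connected G -> (\sum_x (f x == b) = 1)%N -> isomorphic G H.
Proof.
move=> [_ cG] fb.
have fib v : (\sum_x (f x == v) = 1)%N.
  have /connectP[p pp ->] := cG b v.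
  elim: p b fb pp => [|c p IHp] b fb //= /andP[bc pp].
  by apply: IHp pp; rewrite -(covering_fiber_adj bc).
have surj v : exists x, f x == v.
  apply/existsP; apply: contra_eqT (fib v); rewrite negb_exists => /forallP nv.
  by rewrite big1 // => x _; rewrite (negPf (nv x)).
have injf : injective f.
  move=> x y fxy; apply/eqP; apply: contra_eqT (fib (f x)) => xy.
  by rewrite (bigD1 x) //= (bigD1 y) 1?eq_sym //= fxy !eqxx.
pose g v := xchoose (surj v).
have gK : cancel g f by move=> v; apply/eqP; exact: xchooseP (surj v).
have fK : cancel f g by move=> x; apply: injf; rewrite gK.
exists g; first by exists f.
move=> x y; apply/idP/idP.
  move=> a; have := coverf (g x) y; rewrite gK.
  by rewrite /nsum (bigD1 (g y)) //= gK eqxx; case: adj.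
move=> a; apply: contra_eqT (coverf (g x) y) => na.
rewrite gK a /nsum big1 // => z az; case: eqP => // zy.
by move: na; rewrite -zy fK az.
Qed.

End Covering.

Lemma isomorphic_deg (G H : sgraph) (f : G -> H) :
  bijective f -> {mono f : x y / adj x y} -> forall x, deg (f x) = deg x.
Proof.
move=> [g fK gK] fm x; rewrite /deg -(card_imset _ (can_inj gK)).
apply: eq_card => y; rewrite inE; apply/imsetP/idP => [[z + ->]|xy].
  by rewrite inE -{1}(gK z) fm.
by exists (f y); rewrite ?fK // inE fm.
Qed.

Lemma isomorphic_pendant (G H : sgraph) : isomorphic G H ->
  (exists x : G, pendant x) <-> (exists y : H, pendant y).
Proof.
move=> [f fb fm]; have d := isomorphic_deg fb fm; have [g fK gK] := fb.
split=> [] [x px]; first by exists (f x); rewrite /pendant d.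
by exists (g x); rewrite /pendant -d gK.
Qed.

(** * Eigenspaces as spaces of functions *)

Section Eigenfunctions.
Variable R : realType.
Implicit Types (G H : sgraph) (lambda : R).

(** As a sum of differences it does not mention the degree, so at a glued root the contributions of
    the pieces simply add up. *)
Definition lap G (x : G -> R) (v : G) : R := nsum v (fun w => x v - x w).

Definition eigenfun G lambda (x : G -> R) := forall v, lap x v = lambda * x v.

Lemma eigenfun_row G lambda (x : G -> R) :
  (\row_i x (enum_val i) <= eigenspace (laplacian R G) lambda)%MS <->
  eigenfun lambda x.
Proof.
have E v : ((\row_i x (enum_val i)) *m laplacian R G) 0 (enum_rank v) = lap x v.
  rewrite /laplacian mulmxBr mxE !mxE /lap /nsum sumrB; congr (_ - _).
    rewrite (bigD1 (enum_rank v)) //= !mxE enum_rankK eqxx big1 => [|i iv].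
      by rewrite addr0 mulr1n sumr_const -cardsE mulr_natr.
    by rewrite !mxE (negPf iv) mulr0n mulr0.
  rewrite [RHS]big_mkcond [RHS](reindex (@enum_val _ G)) /=; last first.
    by apply: onW_bij; exact: enum_val_bij.
  apply: eq_bigr => i _; rewrite !mxE enum_rankK adj_sym.
  by case: adj; rewrite ?mulr1 ?mulr0.
split=> [/eigenspaceP h v|h].
  by rewrite -E h !mxE enum_rankK.
apply/eigenspaceP/rowP => i; rewrite -(enum_valK i) E h !mxE enum_rankK //.
Qed.

Definition determining G lambda (D : seq G) :=
  forall x, eigenfun lambda x -> {in D, forall v, x v = 0} -> forall v, x v = 0.

Definition realizing G lambda (D : seq G) :=
  forall c : seq R, size c = size D -> exists2 x, eigenfun lambda x & map x D = c.

Section Restriction.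
Variables (G : sgraph) (lambda : R) (D : seq G).
Hypothesis detD : determining lambda D.
Let E := eigenspace (laplacian R G) lambda.
Let S : 'M[R]_(#|G|, size D) :=
  \matrix_(i, j) (enum_val i == tnth (in_tuple D) j)%:R.

Let rowS (x : G -> R) j : ((\row_i x (enum_val i)) *m S) 0 j = x (tnth (in_tuple D) j).
Proof.
rewrite !mxE (bigD1 (enum_rank (tnth (in_tuple D) j))) //= !mxE enum_rankK eqxx mulr1.
rewrite big1 ?addr0 // => i; rewrite -(inj_eq enum_val_inj) enum_rankK !mxE => /negPf->.
by rewrite mulr0.
Qed.

Let row_fun (r : 'rV[R]_#|G|) : r = \row_i (fun v => r 0 (enum_rank v)) (enum_val i).
Proof. by apply/rowP => i; rewrite mxE enum_valK. Qed.

(** Multiplication by [S] is restriction to [D]; by [detD] its kernel meets the eigenspace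
    trivially, so no rank is lost. *)
Let rank_restrict : \rank (E *m S) = mult G lambda.
Proof.
have := mxrank_mul_ker E S.
rewrite /mult -/E => <-; rewrite [X in (_ + X)%N](_ : _ = 0%N) ?addn0 //.
apply/eqP; rewrite mxrank_eq0; apply/eqP/row_matrixP => i.
have := row_sub i (E :&: kermx S)%MS; rewrite sub_capmx => /andP[iE iS].
set r := row i _ in iE iS *; rewrite row0; apply/rowP => j; rewrite [RHS]mxE.
pose x v := r 0 (enum_rank v); have rx : r = \row_i x (enum_val i) := row_fun r.
rewrite rx in iE iS; move/(iffLR (eigenfun_row lambda x)): iE => iE.
rewrite -[j]enum_valK; apply: (detD iE) => v /(tnthP (in_tuple D))[k ->].
by rewrite -rowS; move/sub_kermxP: iS => ->; rewrite mxE.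
Qed.

Lemma mult_realizing : mult G lambda = size D <-> realizing lambda D.
Proof.
rewrite -rank_restrict; split=> [/eqP full c sc|real].
  have := submx_full (\row_j c`_j) full.
  move/submxP => [r]; rewrite mulmxA => rE.
  pose x v := (r *m E) 0 (enum_rank v).
  have rx : r *m E = \row_i x (enum_val i) := row_fun _.
  exists x; first by apply/(iffLR (eigenfun_row lambda x)); rewrite -rx submxMl.
  apply: (@eq_from_nth _ 0); rewrite size_map // => i iD.
  have d0 : G by case: D iD.
  rewrite (nth_map d0) //; have := congr1 (fun M : 'rV_(size D) => M 0 (Ordinal iD)) rE.
  by rewrite rx rowS mxE (tnth_nth d0) /=.
apply/eqP; rewrite -[_ == _]/(row_full (E *m S)) -sub1mx; apply/row_subP => j.
(* Full rank is tested on the unit vectors, each realized as the restriction of an eigenfunction. *)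
have [|x xE xD] := real [seq (k == j)%:R | k <- enum 'I_(size D)].
  by rewrite size_map size_enum_ord.
have -> : row j 1%:M = (\row_i x (enum_val i)) *m S.
  apply/rowP => k; rewrite rowS !mxE.
  have d0 : G := tnth (in_tuple D) k.
  have := congr1 (fun s => nth 0 s k) xD.
  rewrite (nth_map d0) // (nth_map k) ?size_enum_ord // nth_ord_enum.
  by rewrite (tnth_nth d0) eq_sym /= => ->.
by apply: submxMr; apply/(iffRL (eigenfun_row lambda x)).
Qed.

End Restriction.

(** Reindexing exhibits the shifted Laplacian of [G] as a submatrix of that of [H], hence of no
    larger rank. The inverse isomorphism gives the other inequality. *)
Lemma mult_le_iso G H lambda : isomorphic G H -> (mult H lambda <= mult G lambda)%N.
Proof.
move=> [f bf fm]; have d := isomorphic_deg bf fm.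
have c : #|G| = #|H| := bij_eq_card bf.
rewrite /mult /eigenspace !mxrank_ker leq_sub // ?c //.
set M := laplacian R G - _; set N := laplacian R H - _.
have -> : M = mxsub (fun i => enum_rank (f (enum_val i)))
                    (fun i => enum_rank (f (enum_val i))) N.
  apply/matrixP => i j; rewrite !mxE !enum_rankK d fm.
  by rewrite (inj_eq enum_rank_inj) (inj_eq (bij_inj bf)) (inj_eq enum_val_inj).
rewrite (_ : mxsub _ _ N = (rowsub (fun i => enum_rank (f (enum_val i)))
  (rowsub (fun i => enum_rank (f (enum_val i))) N)^T)^T); last first.
  by apply/matrixP => i j; rewrite !mxE.
rewrite mxrank_tr; apply: leq_trans (mxrankS (rowsub_sub _ _)) _.
by rewrite mxrank_tr mxrankS ?rowsub_sub.
Qed.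

Lemma mult_iso G H lambda : isomorphic G H -> mult G lambda = mult H lambda.
Proof.
move=> GH; apply/eqP; rewrite eqn_leq (mult_le_iso _ GH) andbT.
apply: mult_le_iso; have [f [g fK gK] fm] := GH.
by exists g; [exists f | move=> x y; rewrite -fm !gK].
Qed.

End Eigenfunctions.
(** * The recurrence along degree-2 paths *)

Section Recurrence.
Variables (R : realType) (lambda : R).

(** The eigenvalue equation at vertices of degree 2, solved from two initial values. Advancing the
    initial pair keeps the recursion structural; [solSS] recovers the three-term form. *)
Fixpoint sol (a b : R) (n : nat) : R :=
  if n is m.+1 then sol b ((2 - lambda) * b - a) m else a.

Lemma solSS a b n : sol a b n.+2 = (2 - lambda) * sol a b n.+1 - sol a b n.
Proof. by elim: n a b => [|n IHn] a b //=; rewrite -IHn. Qed.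

Definition recur (Y : nat -> R) (n : nat) :=
  forall i, (0 < i < n)%N -> Y i.+1 = (2 - lambda) * Y i - Y i.-1.

Lemma recur_sol a b n : recur (sol a b) n.
Proof. by move=> [|i] // _; rewrite solSS. Qed.

Lemma recurE Y n : recur Y n -> forall i, (i <= n)%N -> Y i = sol (Y 0%N) (Y 1%N) i.
Proof.
move=> rY; suff h i : ((i <= n)%N -> Y i = sol (Y 0%N) (Y 1%N) i) /\
    ((i.+1 <= n)%N -> Y i.+1 = sol (Y 0%N) (Y 1%N) i.+1).
  by move=> i; case: (h i).
elim: i => [|i [IH0 IH1]]; first by split.
by split=> // lt_in; rewrite rY // solSS -IH1 -?IH0 //; lia.
Qed.

Lemma sol_scale c a b n : sol (c * a) (c * b) n = c * sol a b n.
Proof.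
elim: n a b => [|n IHn] a b //=; rewrite -IHn; congr (sol _ _ _); ring.
Qed.

(** Equal initial values occur at a free end of a path, and on the connecting path behind a cycle
    with trivial monodromy. *)
Lemma sol_diag a n : sol a a n = a * sol 1 1 n.
Proof. by rewrite -sol_scale mulr1. Qed.

Lemma sol0 n : sol 0 0 n = 0.
Proof. by rewrite sol_diag mul0r. Qed.

(** The Chebyshev polynomial of the second kind of degree n - 1, evaluated at 1 - lambda / 2. *)
Definition solU := sol 0 1.

Lemma solE a b n : sol a b n.+1 = b * solU n.+1 - a * solU n.
Proof.
rewrite /solU; suff [] : sol a b n.+1 = b * sol 0 1 n.+1 - a * sol 0 1 n /\
  sol a b n.+2 = b * sol 0 1 n.+2 - a * sol 0 1 n.+1 by [].
elim: n => [|n [IH0 IH1]]; first by split=> /=; ring.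
by split=> //; rewrite solSS IH1 IH0 [sol 0 1 n.+3]solSS [sol 0 1 n.+2]solSS; ring.
Qed.

(** One step of the recurrence is a matrix of determinant 1. *)
Lemma solU_wronskian n : solU n.+1 ^+ 2 - solU n * solU n.+2 = 1.
Proof.
rewrite /solU; elim: n => [|n IHn]; first by rewrite /=; ring.
by rewrite -[RHS]IHn [sol 0 1 n.+3]solSS [sol 0 1 n.+2]solSS; ring.
Qed.

(* The recurrence has monodromy the identity after [g] steps. *)
Definition full g := solU g = 0 /\ solU g.-1 = -1.

Lemma solU_lambda0 : lambda = 0 -> forall n, solU n = n%:R.
Proof.
move=> l0; suff E n : solU n = n%:R /\ solU n.+1 = n.+1%:R by move=> n; case: (E n).
elim: n => [|n [IH0 IH1]]; first by [].
split=> //; rewrite /solU solSS -/solU IH0 IH1 l0 -!natr1; ring.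
Qed.

Lemma solU_eq0_lambda n : (0 < n)%N -> solU n = 0 -> lambda != 0.
Proof.
move=> n0 Un; apply/eqP => l0; move/eqP: Un; rewrite solU_lambda0 // pnatr_eq0; lia.
Qed.

Lemma full_neq0 g : full g -> lambda != 0.
Proof.
case: g => [[_ /eqP]|g [Ug _]]; first by rewrite /= eq_sym oppr_eq0 oner_eq0.
exact: solU_eq0_lambda Ug.
Qed.

Lemma full_pred2 g : full g.+2 -> solU g = lambda - 2.
Proof.
move=> [/= U2 U1]; move: (solSS 0 1 g); rewrite -/solU U2 U1 => E.
lra.
Qed.

(** With trivial monodromy [Y g.-1] is the value that the solution would take at index -1, so the
    degree-2 equation holds at index 0 as well. *)
Lemma full_loop g Y : (1 < g)%N -> full g -> recur Y g ->
  Y 1%N + Y g.-1 = (2 - lambda) * Y 0%N.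
Proof.
case: g => [|[|g]] // _ fg rY; have U0 := full_pred2 fg; have [_ /= U1] := fg.
by rewrite (recurE rY (leqnSn _)) solE U1 U0; ring.
Qed.

(** [Y] is [solU] itself, and its return to 0 gives [solU g = 0]; then [Z g] reduces to
    [- Z 0 * solU g.-1], and its return fixes [solU g.-1]. *)
Lemma loop_full g Y Z : (0 < g)%N ->
  recur Y g -> Y g = Y 0%N -> recur Z g -> Z g = Z 0%N ->
  Y 0%N = 0 -> Y 1%N = 1 -> Z 0%N != 0 -> full g.
Proof.
case: g => // g _ rY; rewrite (recurE rY) // => Yg rZ.
rewrite (recurE rZ) // => Zg Y0 Y1 Z0; move: Yg; rewrite Y0 Y1 ; rewrite -/(solU _) => Ug.
split=> //=; move: Zg; rewrite solE Ug mulr0 sub0r => Zg.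
by apply: (mulfI Z0); lra.
Qed.

Lemma full_periodic g a b : (1 < g)%N -> full g ->
  forall n, sol a b (n + g) = sol a b n.
Proof.
case: g => [|[|g]] // _ fg; have U0 := full_pred2 fg; have [/= U2 U1] := fg.
have E n : sol a b (n + g.+2) = sol a b n /\ sol a b (n.+1 + g.+2) = sol a b n.+1.
  elim: n => [|n [IH0 IH1]].
    rewrite add0n add1n [sol _ _ g.+3]solSS ![sol a b _.+1]solE U2 U1 U0 /solU /=.
    by split; ring.
  by split=> //; rewrite !addSn !solSS -!addSn IH0 IH1.
by move=> n; case: (E n).
Qed.

End Recurrence.

(** What an eigenfunction of a glued graph satisfies on one piece: at the root [u] the equation also
    involves the other pieces. *)
Definition preeig (R : realType) (G : sgraph) (lambda : R) (u : G) (x : G -> R) :=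
  forall v, v != u -> lap x v = lambda * x v.

(** * Multiplicities of the model graphs *)

Section Cycle.
Variables (R : realType) (lambda : R) (g : nat) (g3 : (3 <= g)%N).
Variable u : cycle_graph g.
Implicit Type x : cycle_graph g -> R.

Fact cyc_lt j : ((u + j) %% g < g)%N. Proof. by rewrite ltn_pmod //; lia. Qed.
(** Coordinates round the cycle with the root at index 0; indices are unbounded, so that index [g]
    is the root again. *)
Definition cyc j : cycle_graph g := Ordinal (cyc_lt j).

Lemma cyc0 : cyc 0 = u.
Proof. by apply: val_inj; rewrite /= addn0 modn_small. Qed.

Lemma cycg : cyc g = u.
Proof. by apply: val_inj; rewrite /= modnDr modn_small. Qed.

Lemma ordS_cyc j : ordS (cyc j) = cyc j.+1.
Proof. by apply: val_inj; rewrite /= -addn1 modnDml addn1 addnS. Qed.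

Lemma ord_pred_cyc j : ord_pred (cyc j.+1) = cyc j.
Proof. by rewrite -ordS_cyc ordSK. Qed.

Definition cyc_index (v : cycle_graph g) : nat := (v + (g - u)) %% g.

Lemma cyc_indexK v : cyc (cyc_index v) = v.
Proof.
have ug := ltn_ord u; apply: val_inj; rewrite /= /cyc_index modnDmr.
have -> : (u + (v + (g - u)) = v + g)%N by lia.
by rewrite modnDr modn_small // ltn_ord.
Qed.

Lemma cyc_index_cyc j : cyc_index (cyc j) = (j %% g)%N.
Proof.
have ug := ltn_ord u; rewrite /cyc_index /= modnDml.
have -> : (u + j + (g - u) = j + g)%N by lia.
by rewrite modnDr.
Qed.

Lemma cycP v : v != u -> exists2 j, (0 < j < g)%N & v = cyc j.
Proof.
move=> vu; exists (cyc_index v); rewrite ?cyc_indexK // ltn_pmod; last by lia.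
by rewrite andbT lt0n; apply: contra_neq vu => v0; rewrite -(cyc_indexK v) v0 cyc0.
Qed.

Lemma cyc_neq_root j : (0 < j < g)%N -> cyc j != u.
Proof.
move=> /andP[j0 jg]; apply/eqP => /(congr1 cyc_index).
rewrite cyc_index_cyc -[u in cyc_index u]cyc0 cyc_index_cyc mod0n modn_small //; lia.
Qed.

Lemma nsum_cyc (V : nmodType) j (F : cycle_graph g -> V) :
  nsum (cyc j.+1) F = F (cyc j.+2) + F (cyc j).
Proof. by rewrite nsum_cycle // ordS_cyc ord_pred_cyc. Qed.

Lemma nsum_cyc_root (V : nmodType) (F : cycle_graph g -> V) :
  nsum u F = F (cyc 1) + F (cyc g.-1).
Proof.
have gE : cyc g.-1.+1 = u by rewrite prednK ?cycg //; lia.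
by rewrite nsum_cycle // -{1}cyc0 ordS_cyc -gE ord_pred_cyc.
Qed.

Lemma lap_cyc x j : lap x (cyc j.+1) = lambda * x (cyc j.+1) <->
  x (cyc j.+2) = (2 - lambda) * x (cyc j.+1) - x (cyc j).
Proof. by rewrite /lap nsum_cyc; split=> E; lra. Qed.

Lemma preeig_recur x : preeig lambda u x -> recur lambda (x \o cyc) g.
Proof. by move=> px [|j] // jg; apply/lap_cyc/px/cyc_neq_root. Qed.

Lemma preeig_zero x : preeig lambda u x -> x u = 0 -> x (cyc 1) = 0 -> forall v, x v = 0.
Proof.
move=> /preeig_recur rx xu x1 v; have [-> //|/cycP[j /andP[_ /ltnW jg] ->]] := eqVneq v u.
by have /= -> := recurE rx jg; rewrite /= cyc0 xu x1 sol0.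
Qed.

Lemma full_root x : full lambda g -> preeig lambda u x -> lap x u = lambda * x u.
Proof.
move=> fg /preeig_recur rx; have := full_loop _ fg rx.
by rewrite /= cyc0 /lap nsum_cyc_root => /(_ (ltnW g3)) E; lra.
Qed.

Lemma preeig_full x y : preeig lambda u x -> x u = 0 -> x (cyc 1) = 1 ->
  preeig lambda u y -> y u != 0 -> full lambda g.
Proof.
move=> /preeig_recur rx xu x1 /preeig_recur ry yu.
by apply: (loop_full _ rx _ ry); rewrite /= ?cyc0 ?cycg //; lia.
Qed.

Lemma full_real : full lambda g -> forall a b, exists x,
  [/\ eigenfun lambda x, x u = a & x (cyc 1) = b].
Proof.
move=> fg a b; pose x v := sol lambda a b (cyc_index v).
have xE j : x (cyc j) = sol lambda a b j.
  rewrite /x cyc_index_cyc {2}(divn_eq j g); elim: (j %/ g)%N => [|q IHq] //.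
  by rewrite mulSn -addnA addnC full_periodic //; lia.
exists x; split; rewrite ?xE -?{1}cyc0 ?xE //.
move=> v; rewrite -(cyc_indexK v); case: (cyc_index v) => [|j]; last first.
  by apply/lap_cyc; rewrite !xE solSS.
(* The root is read as index [g], where it has a predecessor; periodicity makes [xE] valid there. *)
have -> : cyc 0 = cyc g.-1.+1 by rewrite prednK ?cycg ?cyc0 //; lia.
by apply/lap_cyc; rewrite !xE solSS.
Qed.

Lemma mult_cycle : mult (cycle_graph g) lambda = 2%N <-> full lambda g.
Proof.
have det : determining lambda [:: u; cyc 1].
  move=> x ex x0; apply: preeig_zero => [v _||]; rewrite ?ex //.
    by rewrite x0 // inE eqxx.
  by rewrite x0 // !inE eqxx orbT.
have [m1 m2] := mult_realizing det; split=> [/m1 real|fg].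
  have [//|x ex [xu x1]] := real [:: 0; 1].
  have [//|y ey [yu y1]] := real [:: 1; 0].
  by apply: (@preeig_full x y); rewrite ?yu ?oner_eq0 // => v _; rewrite ?ex ?ey.
apply: m2 => -[|a [|b []]] // _; have [x [ex xu x1]] := full_real fg a b.
by exists x; rewrite //= xu x1.
Qed.

End Cycle.
Section PathMult.
Variables (R : realType) (lambda : R) (m : nat).
Implicit Type p : path_graph m.+1 -> R.

(* Repeating the end values turns the boundary equations into the recurrence. *)
Let ext p (j : nat) := p (inord (minn j.-1 m)).

Let ext_recur p : eigenfun lambda p <-> recur lambda (ext p) m.+2.
Proof.
have lapE (i : path_graph m.+1) :
    lap p i = 2 * ext p i.+1 - ext p i - ext p i.+2.
  have im : (i <= m)%N by have := ltn_ord i; rewrite ltnS.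
  rewrite /lap nsum_path /ext /= (minn_idPl im) inord_val.
  have -> : inord (minn i.-1 m) = inord i.-1 :> path_graph m.+1 by congr inord; lia.
  case: ifP => i0; case: ifP => im'.
  - have -> : inord (minn i.+1 m) = inord i.+1 :> path_graph m.+1 by congr inord; lia.
    by ring.
  - have -> : inord (minn i.+1 m) = i.
      by rewrite -[RHS]inord_val; congr inord; lia.
    by ring.
  - have -> : inord (minn i.+1 m) = inord i.+1 :> path_graph m.+1 by congr inord; lia.
    have -> : inord i.-1 = i by rewrite -[RHS]inord_val; congr inord; lia.
    by ring.
  have -> : inord i.-1 = i by rewrite -[RHS]inord_val; congr inord; lia.
  have -> : inord (minn i.+1 m) = i by rewrite -[RHS]inord_val; congr inord; lia.
  by ring.
have extS (i : path_graph m.+1) : ext p i.+1 = p i.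
  rewrite /ext /= (_ : minn i m = i) ?inord_val //.
  by have := ltn_ord i; rewrite ltnS => /minn_idPl.
split=> [ep [|i] // /andP[_ im]|rp i].
  have := ep (inord i); rewrite lapE -extS inordK //= => E; lra.
have := rp i.+1; rewrite lapE -extS => /(_ (ltn_ord i)) /= E; lra.
Qed.

(** The repeated value at the left end gives equal initial values; the repeated value at the right
    end is the only condition left. *)
Lemma mult_path :
  mult (path_graph m.+1) lambda = 1%N <-> sol lambda 1 1 m.+1 = sol lambda 1 1 m.+2.
Proof.
have extE p : eigenfun lambda p -> forall j, (j <= m.+2)%N ->
    ext p j = p ord0 * sol lambda 1 1 j.
  move=> /ext_recur rp j jm; rewrite (recurE rp jm) -sol_diag.
  rewrite /ext /= min0n (_ : inord 0 = ord0) //.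
  by apply: val_inj; rewrite /= inordK.
have det : determining lambda [:: ord0 : path_graph m.+1].
  move=> p ep p0 v; have v1 : (v.+1 <= m.+2)%N by rewrite ltnS ltnW.
  have := extE p ep _ v1; rewrite p0 ?mem_head // mul0r /ext /=.
  rewrite (_ : minn v m = v) ?inord_val //.
  by have := ltn_ord v; rewrite ltnS => /minn_idPl.
have [m1 m2] := mult_realizing det; split=> [/m1 real|sE].
  have [//|p ep [p0]] := real [:: 1].
  have := extE p ep _ (leqnSn _); have := extE p ep _ (leqnn _).
  by rewrite /ext /= (minn_idPr (leqnSn _)) minnn p0 !mul1r => <- <-.
apply: m2 => -[|a []] // _; exists (fun i : path_graph m.+1 => a * sol lambda 1 1 i.+1); last first.
  by rewrite /= mulr1.
have eE j : (j <= m.+2)%N ->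
    ext (fun i : path_graph m.+1 => a * sol lambda 1 1 i.+1) j = a * sol lambda 1 1 j.
  rewrite /ext inordK; last by rewrite ltnS geq_minr.
  case: (ltngtP j m.+2) => // jm _; last by rewrite jm -[m.+2.-1]/(m.+1) (minn_idPr (leqnSn _)) sE.
  by case: j jm => [|j] jm; rewrite ?min0n //= (minn_idPl _).
apply/ext_recur => -[|i] // im; rewrite !eE //; try lia.
by rewrite solSS; ring.
Qed.

End PathMult.

Section StarEnd.
Variables (R : realType) (lambda : R) (k : nat).
Hypothesis lambda1 : lambda != 1.
Implicit Type x : star_graph k -> R.

(** A leaf of value f beside a centre of value [a] satisfies f - a = lambda f, which is solvable for
    f because lambda is not 1. *)
Definition star_fun (a : R) : star_graph k -> R :=
  fun v => if v is Some _ then a / (1 - lambda) else a.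

Let l1 : 1 - lambda != 0. Proof. by rewrite subr_eq0 eq_sym. Qed.

Lemma star_fun_preeig a : preeig lambda (star_center k) (star_fun a).
Proof.
by case=> // i _; rewrite /lap nsum_star_leaf /=; field.
Qed.

Lemma star_preeigE x : preeig lambda (star_center k) x ->
  x =1 star_fun (x (star_center k)).
Proof.
move=> px [i|] //; have := px (Some i) isT; rewrite /lap nsum_star_leaf /= => E.
by apply: (mulfI l1); rewrite mulrCA mulfV // mulr1; lra.
Qed.

Lemma star_flux x : preeig lambda (star_center k) x ->
  lap x (star_center k) = k%:R * (1 - (1 - lambda)^-1) * x (star_center k).
Proof.
move=> /star_preeigE xE; rewrite /lap nsum_star_center.
rewrite (eq_bigr (fun=> x (star_center k) - x (star_center k) / (1 - lambda))).
  by rewrite sumr_const card_ord -mulr_natl; ring.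
by move=> i _; rewrite [x (Some i)]xE.
Qed.

(* Solvability of a pendant star attached to the far end of a path of [n] steps whose
   first two values agree. *)
Definition star_cond n :=
  k%:R * (1 - (1 - lambda)^-1) * sol lambda 1 1 n
    + (sol lambda 1 1 n - sol lambda 1 1 n.-1) = lambda * sol lambda 1 1 n.

Section Tree.
Variable m : nat.
Local Notation T := (star_path_tree k m.+1).
Local Notation c := (star_center k).

Definition spS (y : star_graph k) : T := glue_inl _ _ y.
Definition spP (i : nat) : T := glue_inr c (ord0 : path_graph m.+1) (inord i).

Lemma spS_root : spS c = spP 0.
Proof.
rewrite /spS /spP -(glue_inr_root c (ord0 : path_graph m.+1)); congr glue_inr.
by apply: val_inj; rewrite /= inordK.
Qed.

(* The path is read from its free end, whose value is repeated at index 0. *)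
Definition tree_ext (X : T -> R) (j : nat) := X (spP (m - j.-1)).

Lemma tree_eigenP (X : T -> R) : eigenfun lambda X <->
  [/\ preeig lambda c (X \o spS), recur lambda (tree_ext X) m.+1 &
   lap (X \o spS) c + (tree_ext X m.+1 - tree_ext X m) = lambda * tree_ext X m.+1].
Proof.
have lapS y : y != c -> lap X (spS y) = lap (X \o spS) y.
  by move=> yc; rewrite /lap nsum_glue_inl.
have lapR : lap X (spS c) = lap (X \o spS) c + (tree_ext X m.+1 - tree_ext X m).
  rewrite /lap nsum_glue_root nsum_path /= add0r; congr (_ + _).
  rewrite /tree_ext /= subnn -spS_root; case: ifP => m0.
    by rewrite (_ : m - m.-1 = 1)%N //; lia.
  (* With no path edge the repeated end value makes the extra difference zero. *)
  by rewrite (_ : m - m.-1 = 0)%N ?subrr -?spS_root ?subrr //; lia.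
have lapP i : (0 < i <= m)%N -> lap X (spP i) =
    2 * tree_ext X (m - i).+1 - tree_ext X (m - i) - tree_ext X (m - i).+2.
  move=> /andP[i0 im]; rewrite /lap nsum_glue_inr; last first.
    by rewrite -val_eqE /= inordK //; lia.
  rewrite nsum_path /= inordK // i0 /tree_ext /=.
  rewrite (_ : m - (m - i) = i)%N; last by lia.
  rewrite (_ : m - (m - i).+1 = i.-1)%N; last by lia.
  rewrite -/(spP i.-1) -/(spP i.+1); case: ifP => im'.
    by rewrite (_ : m - (m - i).-1 = i.+1)%N; [ring | lia].
  by rewrite (_ : m - (m - i).-1 = i)%N; [ring | lia].
split=> [eX|[pS rX eR]].
  split=> [y yc||]; first by rewrite /= -eX lapS.
    case=> [|j] // /andP[_ jm]; have := eX (spP (m - j)); rewrite lapP; last by lia.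
    rewrite (_ : m - (m - j) = j)%N; last by lia.
    by move=> /= E; move: E; rewrite /tree_ext /=; lra.
  by rewrite -lapR eX spS_root /tree_ext /= subnn.
move=> v; have [[y ->]|[i i0 ->]] := glue_vertexP v.
  have [->|yc] := eqVneq y c; first by rewrite lapR eR /tree_ext /= subnn -spS_root.
  by rewrite lapS // pS.
have im : (0 < i <= m)%N.
  by move: i0 (ltn_ord i); rewrite -val_eqE /=; lia.
rewrite (_ : glue_inr _ _ _ = spP i); last by rewrite /spP inord_val.
have := rX (m - i).+1; rewrite lapP // => /(_ ltac:(lia)) /= ->.
rewrite /tree_ext /= (_ : m - (m - i) = i)%N; first by ring.
lia.
Qed.

Lemma mult_star_path_tree : mult T lambda = 1%N <-> star_cond m.+1.
Proof.
have extE X : eigenfun lambda X -> forall j, (j <= m.+1)%N ->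
    tree_ext X j = X (spP m) * sol lambda 1 1 j.
  move=> /tree_eigenP[_ rX _] j jm.
  by rewrite (recurE rX jm) /tree_ext subn0 -sol_diag.
have cE X : X (spS c) = tree_ext X m.+1 by rewrite spS_root /tree_ext subnn.
have det : determining lambda [:: spP m].
  move=> X eX X0; have Xm : X (spP m) = 0 by rewrite X0 ?mem_head.
  have extX j : (j <= m.+1)%N -> tree_ext X j = 0.
    by move=> jm; rewrite extE // Xm mul0r.
  have [pS _ _] := iffLR (tree_eigenP X) eX.
  move=> v; have [[y ->]|[i i0 ->]] := glue_vertexP v.
    rewrite -[LHS]/((X \o spS) y) (star_preeigE pS) /= cE extX //.
    by case: y => [?|] /=; rewrite ?mul0r.
  have im : (m - (m - i))%N = i by have := ltn_ord i; lia.
  rewrite (_ : glue_inr _ _ _ = spP (m - (m - i).+1.-1)).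
    by rewrite -/(tree_ext X _) extX //; lia.
  by rewrite /spP /= im inord_val.
have [m1 m2] := mult_realizing det; split=> [/m1 real|cond].
  have [//|X eX [X1]] := real [:: 1].
  have [pS _] := iffLR (tree_eigenP X) eX.
  by rewrite star_flux //= cE !extE // X1 !mul1r.
apply: m2 => -[|a []] // _.
have [|X [XS XP]] := @glue_rec _ c _ (ord0 : path_graph m.+1) R
  (star_fun (a * sol lambda 1 1 m.+1)) (fun i : path_graph m.+1 => a * sol lambda 1 1 (m - i).+1).
  by rewrite /= subn0.
have tE j : (j <= m.+1)%N -> tree_ext X j = a * sol lambda 1 1 j.
  move=> jm; rewrite /tree_ext XP inordK; last by lia.
  case: j jm => [|j] jm /=; first by rewrite subn0 subnn /= mulr1.
  by rewrite subKn.
exists X; last by rewrite /= /spP XP inordK // subnn /= mulr1.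
have XSE : X \o spS =1 star_fun (a * sol lambda 1 1 m.+1) by exact: XS.
have pS : preeig lambda c (X \o spS).
  move=> v vc; rewrite XSE -star_fun_preeig //.
  by apply: eq_nsum => w; rewrite !XSE.
apply/tree_eigenP; split=> //.
  case=> [|i] // /andP[_ im]; rewrite !tE ?solSS //=; try lia.
  by ring.
move: cond; rewrite star_flux // XSE !tE // /star_cond /= => E.
move: (congr1 (fun z => a * z) E) => E'; lra.
Qed.

End Tree.
End StarEnd.

(** The equations at the two ends of the connecting path, where [alpha] and [beta] are the
    Laplacians of the attached pieces at their roots. For [n = 0] the ends coincide and share one
    equation. *)
Definition join_cond (R : realType) (lambda : R) (n : nat) (alpha beta : R)
    (p : nat -> R) : Prop :=
  if n is m.+1 then
    alpha + (p 0%N - p 1%N) = lambda * p 0%N /\ beta + (p n - p m) = lambda * p n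
  else alpha + beta = lambda * p 0%N.

Lemma join_cond_gt0 (R : realType) (lambda : R) n alpha beta p : (0 < n)%N ->
  join_cond lambda n alpha beta p <->
  alpha + (p 0%N - p 1%N) = lambda * p 0%N /\ beta + (p n - p n.-1) = lambda * p n.
Proof. by case: n. Qed.

Lemma join_cond_eq0 (R : realType) (lambda : R) n alpha beta p : n = 0%N ->
  join_cond lambda n alpha beta p <-> alpha + beta = lambda * p 0%N.
Proof. by move=> ->. Qed.

Section PathJoinEigen.
Variables (R : realType) (lambda : R).
Variables (A : sgraph) (u : A) (B : sgraph) (v : B) (n : nat).
Local Notation K := (path_join u v n.+1).
Implicit Type X : K -> R.
Local Notation inA := (pjA u v n).
Local Notation inP := (pjP u v n).
Local Notation inB := (pjB u v n).

Lemma path_join_eigenP X : eigenfun lambda X <->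
  [/\ preeig lambda u (X \o inA), preeig lambda v (X \o inB),
      recur lambda (X \o inP) n &
      join_cond lambda n (lap (X \o inA) u) (lap (X \o inB) v) (X \o inP)].
Proof.
have lapA a : a != u -> lap X (inA a) = lap (X \o inA) a.
  by move=> au; rewrite /lap nsum_pjA.
have lapB b : b != v -> lap X (inB b) = lap (X \o inB) b.
  by move=> bv; rewrite /lap nsum_pjB.
have lapP i : (0 < i < n)%N ->
    lap X (inP i) = 2 * X (inP i) - X (inP i.-1) - X (inP i.+1).
  by move=> h; rewrite /lap nsum_pjP //; ring.
have endE : join_cond lambda n (lap (X \o inA) u) (lap (X \o inB) v) (X \o inP) <->
    lap X (inA u) = lambda * X (inA u) /\ lap X (inB v) = lambda * X (inB v).
  have Pn : X (inB v) = X (inP n) by rewrite pjB_root.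
  have P0 : X (inA u) = X (inP 0) by rewrite pjA_root.
  case: (posnP n) => [n0|n0].
    have AB : inB v = inA u by rewrite pjB_root n0 pjA_root.
    have E : lap X (inA u) = lap (X \o inA) u + lap (X \o inB) v.
      by rewrite /lap nsum_pj_ends0 //; congr (_ + _); apply: eq_nsum => b; rewrite /= AB.
    by rewrite AB E join_cond_eq0 //= P0; tauto.
  rewrite join_cond_gt0 //.
  have -> : lap X (inA u) = lap (X \o inA) u + (X (inP 0) - X (inP 1)).
    by rewrite /lap nsum_pj_left // -P0.
  have -> : lap X (inB v) = lap (X \o inB) v + (X (inP n) - X (inP n.-1)).
    by rewrite /lap nsum_pj_right // -Pn.
  by rewrite P0 Pn.
split=> [eX|[pA pB rX /endE[eA eB]]].
  split; last by apply/endE.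
  - by move=> a au; rewrite -lapA.
  - by move=> b bv; rewrite -lapB.
  by move=> i h; have := eX (inP i); rewrite lapP //= => E; lra.
move=> z; have [[a ->]|[i h ->]|[b ->]] := path_joinP z.
- by have [-> //|au] := eqVneq a u; rewrite lapA // pA.
- by have := rX i h; rewrite lapP //= => E; lra.
by have [-> //|bv] := eqVneq b v; rewrite lapB // pB.
Qed.

Lemma preeig_eq (G : sgraph) (w : G) (x y : G -> R) : x =1 y -> preeig lambda w x -> preeig lambda w y.
Proof.
by move=> xy px z zw; rewrite -xy -px //; apply: eq_nsum => t; rewrite !xy.
Qed.

Lemma path_join_eigen f p h : preeig lambda u f -> preeig lambda v h ->
  recur lambda p n -> f u = p 0%N -> p n = h v -> join_cond lambda n (lap f u) (lap h v) p ->
  exists X, [/\ eigenfun lambda X, X \o inA =1 f & X \o inB =1 h].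
Proof.
move=> pf ph rp fp ph' jc; have [X [XA XP XB]] := path_join_rec fp ph'.
exists X; split=> //; apply/path_join_eigenP; split.
- by apply: preeig_eq pf => a; rewrite /= XA.
- by apply: preeig_eq ph => b; rewrite /= XB.
- move=> i h'; have /andP[_ lt_in] := h'; rewrite /= !XP ?rp // ?(ltnW lt_in) //.
  exact: leq_trans (leq_pred i) (ltnW lt_in).
have -> : lap (X \o inA) u = lap f u by apply: eq_nsum => a; rewrite /= !XA.
have -> : lap (X \o inB) v = lap h v by apply: eq_nsum => b; rewrite /= !XB.
case: (posnP n) => n0; last first.
  by apply/(join_cond_gt0 _ _ _ _ n0); rewrite /= !XP ?leq_pred //; apply/join_cond_gt0.
by move: jc; rewrite !join_cond_eq0 //= XP.
Qed.

End PathJoinEigen.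

(** * Optimality of the two families of model graphs *)

Section Optimal.
Variables (R : realType) (lambda : R) (n : nat).
Variables (g : nat) (g3 : (3 <= g)%N) (u : cycle_graph g).
Local Notation s := (sol lambda 1 1).
Local Notation u1 := (cyc g3 u 1).

(** The values at the root and next to it propagate round the cycle; the root equation then gives
    the next value on the path, and the value reached at the centre determines the leaves. *)
Lemma mult_cycle_star k : lambda != 1 -> (0 < k)%N ->
  mult (path_join u (star_center k) n.+1) lambda = 2%N <->
  [/\ (0 < n)%N, full lambda g & star_cond lambda k n].
Proof.
move=> lambda1 k0; set K := path_join _ _ _.
have l1 : 1 - lambda != 0 by rewrite subr_eq0 eq_sym.
pose a0 : K := pjA u (star_center k) n u; pose a1 : K := pjA u (star_center k) n u1.
have starE (X : K -> R) : eigenfun lambda X ->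
    X \o pjB u (star_center k) n =1 star_fun lambda (X (pjP u (star_center k) n n)).
  move=> /path_join_eigenP[_ pB _ _] z; rewrite (star_preeigE lambda1 pB) /=.
  by rewrite pjB_root.
have det : determining lambda [:: a0; a1].
  move=> X eX X0; have Xa0 : X a0 = 0 by rewrite X0 ?mem_head.
  have Xa1 : X a1 = 0 by rewrite X0 // !inE eqxx orbT.
  have [pA pB rX jc] := iffLR (path_join_eigenP lambda X) eX.
  have XA a : X (pjA u (star_center k) n a) = 0 := preeig_zero pA Xa0 Xa1 a.
  have P0 : X (pjP u (star_center k) n 0) = 0 by rewrite -pjA_root.
  have XP i : (i <= n)%N -> X (pjP u (star_center k) n i) = 0.
    case: (posnP n) => [n0 i0|n0]; first by rewrite (_ : i = 0%N) //; lia.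
    move=> le_in; move: (recurE rX le_in) => /= ->; rewrite P0.
    suff -> : X (pjP u (star_center k) n 1) = 0 by rewrite sol0.
    have lA : lap (X \o pjA u (star_center k) n) u = 0.
      by rewrite /lap /nsum big1 // => y _; rewrite /= !XA subrr.
    by have [+ _] := iffLR (join_cond_gt0 _ _ _ _ n0) jc; rewrite lA /= P0 => E; lra.
  move=> z; have [[a ->]|[i /andP[_ /ltnW h] ->]|[b ->]] := path_joinP z; rewrite ?XA ?XP //.
  by have := starE X eX b; rewrite /= XP //= => ->; case: b => [?|] /=; rewrite ?mul0r.
have [m1 m2] := mult_realizing det; split=> [/m1 real|[n0 fg sc]].
  have [//|X eX [X0 X1]] := real [:: 0; 1].
  have [//|Y eY [Y0 Y1]] := real [:: 1; 0].
  have [pX _ _ _] := iffLR (path_join_eigenP lambda X) eX.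
  have [pY pB rY jc] := iffLR (path_join_eigenP lambda Y) eY.
  have fg : full lambda g by apply: (preeig_full pX X0 X1 pY); rewrite /= Y0 oner_eq0.
  have YP0 : Y (pjP u (star_center k) n 0) = 1 by rewrite -pjA_root.
  have k0R : k%:R != 0 :> R by rewrite pnatr_eq0 -lt0n.
  have l0 := full_neq0 fg.
  move: jc; rewrite (full_root g3 fg pY) (star_flux lambda1 pB).
  rewrite [(Y \o pjB _ _ _) _]/= [(Y \o pjA _ _ _) _]/= -/a0 Y0 pjB_root.
  case: (posnP n) => [n0|n0].
    (* For l = 1 the cycle already supplies [lambda * Y] at the root, so the contribution of the
       star must vanish, which forces lambda = 0. *)
    rewrite join_cond_eq0 // (_ : pjP _ _ _ n = pjP _ _ _ 0); last by congr (pjP _ _ _ _).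
    rewrite /= YP0 => E; exfalso.
    have : k%:R * (1 - (1 - lambda)^-1) = 0 by lra.
    move/eqP; rewrite mulf_eq0 (negPf k0R) /= => /eqP E2.
    have E3 : (1 - lambda) * (1 - lambda)^-1 = 1 by rewrite mulfV.
    have E4 : (1 - lambda)^-1 = 1 by lra.
    by move/eqP: l0; apply; move: E3; rewrite E4; lra.
  move/(iffLR (join_cond_gt0 _ _ _ _ n0)) => /= [E1 E2].
  have YP1 : Y (pjP u (star_center k) n 1) = 1 by move: E1; rewrite YP0; lra.
  have YPE i : (i <= n)%N -> Y (pjP u (star_center k) n i) = s i.
    by move=> le_in; move: (recurE rY le_in) => /= ->; rewrite YP0 YP1.
  by split=> //; rewrite /star_cond -!YPE ?leq_pred.
apply: m2 => -[|a [|b []]] // _; have [f [ef fu fu1]] := full_real g3 u fg a b.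
have pf : preeig lambda u f by move=> z _.
(* The path starts with the values [a], [a], so it reaches the centre with value [a * s n]. *)
have ph : preeig lambda (star_center k) (@star_fun R lambda k (a * s n)).
  exact: star_fun_preeig.
have rp : recur lambda (sol lambda a a) n := @recur_sol _ _ _ _ _.
have [|||X [eX XA _]] := path_join_eigen pf ph rp => //.
- by rewrite sol_diag.
- apply/(join_cond_gt0 _ _ _ _ n0); rewrite ef fu (star_flux lambda1 ph) !(sol_diag _ a) /=.
  split; first by ring.
  by move: (congr1 (fun z => a * z) sc); rewrite /= => E; lra.
exists X => //=; have := XA u; have := XA u1; rewrite /= -/a0 -/a1 => -> ->.
by rewrite fu fu1.
Qed.

Lemma mult_cycle_cycle g' (g3' : (3 <= g')%N) (w : cycle_graph g') :
  mult (path_join u w n.+1) lambda = 3%N <->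
  [/\ (0 < n)%N, full lambda g, full lambda g' & s n = s n.-1].
Proof.
set K := path_join _ _ _; pose w1 := cyc g3' w 1.
(* Two values suffice on the first cycle; the path carries them to [w], so only the neighbour [w1]
   remains to be prescribed. *)
pose a0 : K := pjA u w n u; pose a1 : K := pjA u w n u1; pose b1 : K := pjB u w n w1.
have zeroP (X : K -> R) : eigenfun lambda X -> X a0 = 0 -> X a1 = 0 ->
    (forall a, X (pjA u w n a) = 0) /\ (forall i, (i <= n)%N -> X (pjP u w n i) = 0).
  move=> eX Xa0 Xa1.
  have [pA pB rX jc] := iffLR (path_join_eigenP lambda X) eX.
  have XA a : X (pjA u w n a) = 0 := preeig_zero pA Xa0 Xa1 a.
  split=> // i.
  have P0 : X (pjP u w n 0) = 0 by rewrite -pjA_root.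
  case: (posnP n) => [n0 i0|n0]; first by rewrite (_ : i = 0%N) //; lia.
  move=> le_in; move: (recurE rX le_in) => /= ->; rewrite P0.
  suff -> : X (pjP u w n 1) = 0 by rewrite sol0.
  have lA : lap (X \o pjA u w n) u = 0.
    by rewrite /lap /nsum big1 // => y _; rewrite /= !XA subrr.
  by have [+ _] := iffLR (join_cond_gt0 _ _ _ _ n0) jc; rewrite lA /= P0 => E; lra.
have det : determining lambda [:: a0; a1; b1].
  move=> X eX X0; have Xa0 : X a0 = 0 by rewrite X0 ?mem_head.
  have Xa1 : X a1 = 0 by rewrite X0 // !inE eqxx orbT.
  have Xb1 : X b1 = 0 by rewrite X0 // !inE eqxx !orbT.
  have [XA XP] := zeroP X eX Xa0 Xa1.
  have [pA pB rX jc] := iffLR (path_join_eigenP lambda X) eX.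
  have XB b : X (pjB u w n b) = 0.
    by apply: (preeig_zero pB) => //=; rewrite pjB_root XP.
  by move=> z; have [[a ->]|[i /andP[_ /ltnW h] ->]|[b ->]] := path_joinP z; rewrite ?XA ?XP.
have [m1 m2] := mult_realizing det; split=> [/m1 real|[n0 fg fg' sn]].
  have [//|X eX [X0 X1 _]] := real [:: 0; 1; 0].
  have [//|Y eY [Y0 Y1 Yb]] := real [:: 1; 0; 0].
  have [//|Z eZ [Z0 Z1 Zb]] := real [:: 0; 0; 1].
  have [pX _ _ _] := iffLR (path_join_eigenP lambda X) eX.
  have [_ pZ _ _] := iffLR (path_join_eigenP lambda Z) eZ.
  have [pY pB rY jc] := iffLR (path_join_eigenP lambda Y) eY.
  have fg : full lambda g by apply: (preeig_full pX X0 X1 pY); rewrite /= Y0 oner_eq0.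
  have YP0 : Y (pjP u w n 0) = 1 by rewrite -pjA_root.
  have l0 := full_neq0 fg.
  have [_ ZP] := zeroP Z eZ Z0 Z1.
  have Zw : (Z \o pjB u w n) w = 0 by rewrite /= pjB_root ZP.
  (* On the second cycle [Z] is 0 at the root and 1 next to it, so a function nonzero at [w] is
     still needed. If [Y] vanished at [w], it would vanish on the second cycle, and the path read
     backwards would carry 0 to [u], where [Y] is 1. *)
  have Yn : Y (pjP u w n n) != 0.
    apply/eqP => Yn; have Yw : (Y \o pjB u w n) w = 0 by rewrite /= pjB_root.
    have YB b : Y (pjB u w n b) = 0 := preeig_zero pB Yw Yb b.
    have lB : lap (Y \o pjB u w n) w = 0.
      by rewrite /lap /nsum big1 // => y _; rewrite /= !YB subrr.
    have YE i : (i <= n)%N -> Y (pjP u w n (n - i)) = 0.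
      have rY' : recur lambda (fun i => Y (pjP u w n (n - i))) n.
        move=> j jn; have /= := rY (n - j)%N (ltac:(lia)).
        have -> : ((n - j).+1 = n - j.-1)%N by lia.
        have -> : ((n - j).-1 = n - j.+1)%N by lia.
        by move=> E; lra.
      move=> le_in; move: (recurE rY' le_in) => /= ->; rewrite subn0 Yn.
      case: (posnP n) => [n0|n0]; first by rewrite (_ : i = 0%N) //; lia.
      suff -> : Y (pjP u w n (n - 1)) = 0 by rewrite sol0.
      have [_ /= +] := iffLR (join_cond_gt0 _ _ _ _ n0) jc.
      by rewrite lB Yn subn1 => E; lra.
    by have := YE n (leqnn n); rewrite subnn YP0 => /eqP; rewrite oner_eq0.
  have fg' : full lambda g'.
    by apply: (preeig_full pZ Zw Zb pB); rewrite /= pjB_root.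
  move: jc; rewrite (full_root g3 fg pY) (full_root g3' fg' pB).
  rewrite [(Y \o pjB _ _ _) _]/= [(Y \o pjA _ _ _) _]/= -/a0 Y0 pjB_root.
  case: (posnP n) => [n0|n0].
    rewrite join_cond_eq0 // (_ : pjP _ _ _ n = pjP _ _ _ 0); last by congr (pjP _ _ _ _).
    rewrite /= YP0 => E; exfalso.
    (* Both cycles supply [lambda * Y] at the common root, so 2 lambda = lambda. *)
    by move/eqP: l0; apply; lra.
  move/(iffLR (join_cond_gt0 _ _ _ _ n0)) => /= [E1 E2].
  have YP1 : Y (pjP u w n 1) = 1 by move: E1; rewrite YP0; lra.
  have YPE i : (i <= n)%N -> Y (pjP u w n i) = s i.
    by move=> le_in; move: (recurE rY le_in) => /= ->; rewrite YP0 YP1.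
  by split=> //; move: E2; rewrite !YPE ?leq_pred // => E; lra.
apply: m2 => -[|a [|b [|c []]]] // _; have [f [ef fu fu1]] := full_real g3 u fg a b.
have [h [eh hw hw1]] := full_real g3' w fg' (a * s n) c.
have pf : preeig lambda u f by move=> z _.
have ph : preeig lambda w h by move=> z _.
have rp : recur lambda (sol lambda a a) n := @recur_sol _ _ _ _ _.
have [|||X [eX XA XB]] := path_join_eigen pf ph rp => //.
- by rewrite hw sol_diag.
- apply/(join_cond_gt0 _ _ _ _ n0); rewrite ef fu eh hw !(sol_diag _ a) sn /=.
  by split; ring.
exists X => //=; have := XA u; have := XA u1; have := XB w1.
by rewrite /= -/a0 -/a1 -/b1 => -> -> ->; rewrite fu fu1 hw1.
Qed.

End Optimal.

(** * Threads of degree-2 vertices *)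

Section Neighbours.
Variables (G : sgraph) (x : G).

Lemma adj_nbrs (s : seq G) : uniq s -> all (adj x) s -> size s = deg x ->
  forall v, adj x v = (v \in s).
Proof.
move=> us /allP sx ds v.
have /eqP E : [set y in s] == [set y | adj x y].
  have sE : #|[set y in s]| = size s by rewrite cardsE; apply/card_uniqP.
  rewrite eqEcard sE -/(deg x) ds leqnn andbT.
  by apply/subsetP => y; rewrite !inE => /sx.
by move/setP: E => /(_ v); rewrite !inE.
Qed.

Lemma nsum_nbrs (V : nmodType) (s : seq G) (F : G -> V) :
  uniq s -> all (adj x) s -> size s = deg x -> nsum x F = \sum_(y <- s) F y.
Proof.
move=> us sx ds; rewrite /nsum (eq_bigl (mem s)); last exact: adj_nbrs.
by rewrite big_uniq.
Qed.

Lemma adj_count (s : seq G) : uniq s -> all (adj x) s -> size s = deg x ->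
  forall v, (adj x v : nat) = count_mem v s.
Proof. by move=> us sx ds v; rewrite count_uniq_mem // (adj_nbrs us). Qed.

Lemma deg2_unique a b c : deg x = 2%N -> adj x a -> adj x b -> adj x c ->
  a != b -> a != c -> b = c.
Proof.
move=> d2 xa xb xc ab ac; have := @adj_nbrs [:: a; b] _ _ _ c.
rewrite /= !inE ab xa xb xc d2 => /(_ isT isT erefl).
by rewrite (eq_sym c a) (negPf ac) /= => /esym/eqP.
Qed.

End Neighbours.

Section Threads.
Variables (G : sgraph) (B : pred G).
Hypothesis degB : forall v, ~~ B v -> deg v = 2%N.

(** [B] marks the vertices where a path stops, and the last clause forbids turning back. The two
    ends may coincide, so loops are included. *)
Definition thread (n : nat) (y : nat -> G) : Prop :=
  [/\ (0 < n)%N, B (y 0%N) /\ B (y n), forall i, (0 < i < n)%N -> ~~ B (y i),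
      forall i, (i < n)%N -> adj (y i) (y i.+1) &
      forall i, (i.+1 < n)%N -> y i != y i.+2].

Lemma thread_rev n y : thread n y -> thread n (fun i => y (n - i)%N).
Proof.
move=> [n0 [B0 Bn] nB ay by_]; split=> //; rewrite ?subn0 ?subnn //.
- by move=> i h; apply: nB; lia.
- move=> i h; rewrite adj_sym.
  have -> : (n - i = (n - i.+1).+1)%N by lia.
  by apply: ay; lia.
- move=> i h; rewrite eq_sym.
  have -> : (n - i = (n - i.+2).+2)%N by lia.
  by apply: by_; lia.
Qed.

(** At a vertex of degree 2 a walk that does not turn back has one continuation, and it stops at the
    first vertex of [B]. *)
Lemma thread_det n y m z : thread n y -> thread m z ->
  y 0%N = z 0%N -> y 1%N = z 1%N -> n = m /\ forall i, (i <= n)%N -> y i = z i.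
Proof.
move=> [n0 [_ Bn] nB ay by_] [m0 [_ Bm] mB az bz] yz0 yz1.
have E i : ((i <= n)%N -> (i <= m)%N -> y i = z i) /\
    ((i.+1 <= n)%N -> (i.+1 <= m)%N -> y i.+1 = z i.+1).
  elim: i => [|i [IH0 IH1]]; first by split.
  split=> // iN iM; have y1 := IH1 (ltnW iN) (ltnW iM).
  have y0 := IH0 (ltnW (ltnW iN)) (ltnW (ltnW iM)).
  apply: (@deg2_unique _ (y i.+1) (y i)); rewrite ?ay ?by_ //.
  - by apply/degB/nB.
  - by rewrite adj_sym ay // ltnW.
  - by rewrite y1 az.
  - by rewrite y0 bz.
have nm : n = m.
  case: (ltngtP n m) => // nm.
    by have := mB n; rewrite n0 nm => /(_ isT); rewrite -(E n).1 ?Bn // ltnW.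
  by have := nB m; rewrite m0 nm => /(_ isT); rewrite (E m).1 ?Bm // ltnW.
by split=> // i iN; apply: (E i).1; rewrite -?nm.
Qed.

Lemma thread_exists b a : B b -> adj b a ->
  exists n y, [/\ thread n y, y 0%N = b & y 1%N = a].
Proof.
(* [nx] moves on to a neighbour other than the previous vertex. Its default value can occur only at
   a vertex of [B], since the others have degree 2. *)
move=> Bb ab; pose nx (d : G * G) := odflt d.2 [pick w | adj d.2 w && (w != d.1)].
pose dart i := iter i (fun d => (d.2, nx d)) (b, a); pose y i := (dart i).1.
have dartE i : dart i = (y i, y i.+1) by rewrite /y /=; case: (dart i).
have nxP i : adj (y i) (y i.+1) -> ~~ B (y i.+1) ->
    adj (y i.+1) (y i.+2) /\ y i != y i.+2.
  move=> ay nB; have -> : y i.+2 = nx (y i, y i.+1) by rewrite -dartE.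
  rewrite /nx /=; case: pickP => [w /andP[-> wy]|no]; first by rewrite eq_sym.
  have : [set v | adj (y i.+1) v] \subset [set y i].
    apply/subsetP => v; rewrite !inE => av.
    by move: (no v); rewrite av /= => /negbT; rewrite negbK.
  by move/subset_leq_card; rewrite cards1 -/(deg _) degB.
have walk n : (forall i, (0 < i < n)%N -> ~~ B (y i)) ->
    (forall i, (i < n)%N -> adj (y i) (y i.+1)) /\
    (forall i, (i.+1 < n)%N -> y i != y i.+2).
  move=> nB; suff A i : (i < n)%N -> adj (y i) (y i.+1).
    by split=> // i h; apply: (nxP i _ _).2; rewrite ?A ?nB // ltnW.
  elim: i => [//|i IHi] h; apply: (nxP i _ _).1; rewrite ?IHi ?nB //; exact: ltnW.
(* If [B] is not met within [N] steps, pigeonhole on darts gives a repetition, which is traced back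
   to the start, so the walk returns to [b]. *)
have [n nP] : exists n, (0 < n)%N && B (y n).
  pose N := #|{: G * G}|.+1; pose f (i : 'I_N) := dart i.
  have /injectivePn[i [j ij fij]] : ~~ injectiveb f.
    by apply/negP => /injectiveP/leq_card; rewrite card_ord /N ltnn.
  wlog lt_ij : i j ij fij / (i < j)%N.
    move=> W; case: (ltngtP i j) => h; first exact: (W i j).
      by apply: (W j i); rewrite 1?eq_sym.
    by move: ij; rewrite -val_eqE /= h eqxx.
  have [/existsP[k kP]|/existsPn nB] := boolP [exists k : 'I_N, (0 < k)%N && B (y k)].
    by exists k.
  have nB' k : (0 < k < N)%N -> ~~ B (y k).
    by move=> /andP[k0 kN]; have := nB (Ordinal kN); rewrite /= k0.
  have [ay by_] := walk N nB'.
  (* The walk is reversible, so a repeated dart can be traced back to the initial one. *)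
  have back k : (k <= i)%N -> dart (i - k)%N = dart (j - k)%N.
    elim: k => [|k IHk] ki; first by rewrite !subn0.
    move: (IHk (ltnW ki)).
    have -> : (i - k = (i - k.+1).+1)%N by lia.
    have -> : (j - k = (j - k.+1).+1)%N by lia.
    rewrite !dartE => -[E1 E2]; rewrite E1; congr (_, _).
    have jN := ltn_ord j; have iN := ltn_ord i.
    apply: (@deg2_unique _ (y (i - k.+1).+1) (y (i - k.+1).+2)).
    - by apply/degB/nB'; lia.
    - by apply: ay; lia.
    - by rewrite adj_sym; apply: ay; lia.
    - by rewrite E1 adj_sym; apply: ay; lia.
    - by rewrite eq_sym; apply: by_; lia.
    - by rewrite E2 eq_sym; apply: by_; lia.
  exists (j - i)%N; rewrite subn_gt0 lt_ij /=.
  by have := back i (leqnn _); rewrite subnn /y => <-.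
have [n0 n0P nmin] := ex_minnP (ex_intro (fun n => (0 < n)%N && B (y n)) n nP).
case/andP: n0P => n0_gt0 Bn.
have nB i : (0 < i < n0)%N -> ~~ B (y i).
  by move=> /andP[i0 iN]; apply/negP => Bi; have := nmin i; rewrite i0 Bi leqNgt iN => /(_ isT).
have [ay by_] := walk n0 nB.
by exists n0, y; split.
Qed.

(* A thread is recorded by its two end darts, each pointing into the thread. *)
Definition threads n y (d e : G * G) :=
  [/\ thread n y, (y 0%N, y 1%N) = d & (y n, y n.-1) = e].

Definition linked d e := exists n y, threads n y d e.

Lemma linked_exists b a : B b -> adj b a ->
  exists e, [/\ B e.1, adj e.1 e.2 & linked (b, a) e].
Proof.
move=> Bb ab; have [n [y [ty y0 y1]]] := thread_exists Bb ab.
exists (y n, y n.-1); split; last by exists n, y; split=> //; rewrite y0 y1.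
  by case: ty => _ [].
by case: ty => n0 _ _ ay _; rewrite /= adj_sym -{2}(prednK n0) ay // prednK.
Qed.

Lemma linked_sym d e : linked d e -> linked e d.
Proof.
move=> [n [y [ty dE eE]]]; exists n, (fun i => y (n - i)%N); split.
- exact: thread_rev.
- by rewrite subn0 subn1.
- by rewrite subnn -dE; case: ty => n0 _ _ _ _; rewrite (_ : n - n.-1 = 1)%N //; lia.
Qed.

Lemma linked_fun d e e' : linked d e -> linked d e' -> e = e'.
Proof.
move=> [n [y [ty dE <-]]] [m [z [tz dE' <-]]].
have [y0 y1] : y 0%N = z 0%N /\ y 1%N = z 1%N by move: dE; rewrite -dE' => -[].
have [nm E] := thread_det ty tz y0 y1.
by rewrite -nm !E ?leq_pred.
Qed.

(** Such a thread would equal its own reversal; at its middle there would be a loop edge if its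
    length is odd, and a turn back if it is even. *)
Lemma linked_irr d : ~ linked d d.
Proof.
move=> [n [y [ty dE eE]]].
have [y0 y1] : y 0%N = y n /\ y 1%N = y n.-1 by move: dE; rewrite -eE => -[].
have [_ E] := thread_det ty (thread_rev ty) (etrans y0 (congr1 y (esym (subn0 n))))
  (etrans y1 (congr1 y (esym (subn1 n)))).
have [n0 _ _ ay by_] := ty; have nE := odd_double_half n.
set m := n./2 in nE; case: (odd n) nE => /= nE.
  have := E m (ltac:(lia)); have -> : (n - m = m.+1)%N by lia.
  by move=> h; have := ay m (ltac:(lia)); rewrite -h adj_irr.
have := E m.-1 (ltac:(lia)); have -> : (n - m.-1 = m.-1.+2)%N by lia.
by move=> h; have := by_ m.-1 (ltac:(lia)); rewrite -h eqxx.
Qed.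

Lemma thread_adj n y i : thread n y -> (0 < i < n)%N ->
  [/\ uniq [:: y i.-1; y i.+1], all (adj (y i)) [:: y i.-1; y i.+1]
    & size [:: y i.-1; y i.+1] = deg (y i)].
Proof.
move=> [_ _ nB ay by_] h; have /andP[i0 iN] := h; rewrite degB ?nB //.
case: i i0 iN {h} => // i _ iN.
by rewrite /= inE andbT by_ // adj_sym !ay // ltnW.
Qed.

End Threads.

(** The covering condition at one vertex, so that each piece of a path join can be treated apart
    from its root. *)
Definition covers_at (H G : sgraph) (f : H -> G) (x : H) :=
  forall w, nsum x (fun y => (f y == w) : nat) = adj (f x) w.

(** [f], [p] and [h] glue to a covering. The last four hypotheses say that [p 0] is attained only at
    the root of [A]: the singleton fibre required by [covering_iso]. *)
Lemma path_join_iso (G A B : sgraph) (u : A) (v : B) (n : nat)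
    (f : A -> G) (p : nat -> G) (h : B -> G) :
  connected G -> f u = p 0%N -> p n = h v ->
  (forall a, a != u -> covers_at f a) -> (forall b, b != v -> covers_at h b) ->
  (forall i w, (0 < i < n)%N -> ((p i.-1 == w) + (p i.+1 == w) = adj (p i) w)%N) ->
  (n = 0%N -> forall w, (nsum u (fun y => (f y == w) : nat) +
     nsum v (fun y => (h y == w) : nat) = adj (p 0%N) w)%N) ->
  ((0 < n)%N -> forall w,
     (nsum u (fun y => (f y == w) : nat) + (p 1%N == w) = adj (p 0%N) w)%N) ->
  ((0 < n)%N -> forall w,
     (nsum v (fun y => (h y == w) : nat) + (p n.-1 == w) = adj (p n) w)%N) ->
  (forall a, a != u -> f a != p 0%N) -> (forall i, (0 < i < n)%N -> p i != p 0%N) ->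
  (forall b, b != v -> h b != p 0%N) -> ((0 < n)%N -> p n != p 0%N) ->
  isomorphic G (path_join u v n.+1).
Proof.
move=> cG fp ph cf ch cp c0 cl cr uf up uh un.
have [X [XA XP XB]] := path_join_rec fp ph.
have sumA w a : nsum a ((fun y => (X y == w) : nat) \o pjA u v n) =
    nsum a (fun y => (f y == w) : nat) by apply: eq_nsum => y /=; rewrite XA.
have sumB w b : nsum b ((fun y => (X y == w) : nat) \o pjB u v n) =
    nsum b (fun y => (h y == w) : nat) by apply: eq_nsum => y /=; rewrite XB.
have coverX x w : nsum x (fun y => (X y == w) : nat) = adj (X x) w.
  have [[a ->]|[i hi ->]|[b ->]] := path_joinP x.
  - have [->|au] := eqVneq a u; last by rewrite nsum_pjA // sumA XA cf.
    rewrite XA fp; case: (posnP n) => n0.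
      by rewrite nsum_pj_ends0 // sumA sumB; exact: c0.
    by rewrite nsum_pj_left // sumA XP //; exact: cl.
  - by rewrite nsum_pjP // !XP; [exact: cp | lia..].
  have [->|bv] := eqVneq b v; last by rewrite nsum_pjB // sumB XB ch.
  rewrite XB -ph; case: (posnP n) => n0.
    rewrite pjB_root (_ : pjP _ _ _ n = pjP _ _ _ 0); last by congr (pjP _ _ _ _).
    rewrite -pjA_root nsum_pj_ends0 // sumA sumB (_ : p n = p 0%N); last by congr p.
    exact: c0.
  by rewrite nsum_pj_right // sumB XP ?leq_pred //; exact: cr.
apply: (@covering_iso _ _ X coverX (p 0%N) cG).
suff uniqX x : x != pjA u v n u -> X x != p 0%N.
  by rewrite (bigD1 (pjA u v n u)) //= XA fp eqxx big1 // => x /uniqX/negPf->.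
move=> xu.
have [[a xE]|[i hi ->]|[b xE]] := path_joinP x.
- by rewrite xE XA uf //; apply/eqP => au; move: xu; rewrite xE au eqxx.
- by rewrite XP ?up //; lia.
rewrite xE XB; have [bv|/uh //] := eqVneq b v.
rewrite bv -ph un // lt0n; apply/eqP => n0; move: xu; rewrite xE bv pjB_root pjA_root.
by rewrite (_ : pjP _ _ _ n = pjP _ _ _ 0) ?eqxx //; congr (pjP _ _ _ _).
Qed.

Section Loop.
Variables (G : sgraph) (B : pred G).
Hypothesis degB : forall v, ~~ B v -> deg v = 2%N.
Variables (z a b : G).

(** A closed thread is a map from the cycle of its length. At the root only the two end darts are
    counted, because [z] may have further neighbours in [G]. *)
Lemma loop_cycle : linked B (z, a) (z, b) ->
  exists g (u : cycle_graph g) (f : cycle_graph g -> G), (3 <= g)%N /\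
    [/\ f u = z, forall x, x != u -> covers_at f x, forall x, x != u -> ~~ B (f x) &
     forall w, nsum u (fun y => (f y == w) : nat) = ((a == w) + (b == w))%N].
Proof.
move=> lab; have [n [y [ty [y0 y1] [yn yn1]]]] := lab.
have ab : a != b by apply/eqP => ab; apply: (linked_irr degB (d := (z, a))); rewrite {2}ab.
have [n0 _ nB ay _] := ty.
(* Length 1 would be a loop edge, and length 2 would give [a = b]. *)
have n3 : (3 <= n)%N.
  case: n n0 ay yn yn1 {ty nB} => [|[|[|n]]] // _ ay yn yn1.
    by have := ay 0%N isT; rewrite yn y0 adj_irr.
  by move: ab; rewrite -y1 -yn1 eqxx.
pose u : cycle_graph n := Ordinal n0; pose f (i : cycle_graph n) := y i.
have fc j : (j <= n)%N -> f (cyc n3 u j) = y j.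
  rewrite /f /= add0n leq_eqVlt => /orP[/eqP->|jn]; last by rewrite modn_small.
  by rewrite modnn y0 yn.
exists n, u, f; split=> //; split=> //.
- move=> x /(cycP n3)[j hj ->] w; rewrite fc; last by lia.
  have [us sa sd] := thread_adj degB ty hj; rewrite (adj_count us sa sd) /=.
  case: j hj {us sa sd} => // j hj; rewrite nsum_cyc !fc; try lia.
  by rewrite addn0 addnC.
- by move=> x /(cycP n3)[j hj ->]; rewrite fc ?nB //; lia.
by move=> w; rewrite (nsum_cyc_root n3) !fc ?y1 ?yn1 // leq_pred.
Qed.

End Loop.

(** * Theta graphs never have multiplicity 3 *)

Section Theta.
Variables (R : realType) (G : sgraph) (B : pred G).
Hypothesis degB : forall v, ~~ B v -> deg v = 2%N.
Variable lambda : R.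

Lemma eigenfun_deg (x : G -> R) (v : G) : eigenfun lambda x ->
  (deg v)%:R * x v - nsum v x = lambda * x v.
Proof.
by move=> ex; rewrite -ex /lap /nsum sumrB sumr_const mulr_natl /deg cardsE.
Qed.

Lemma thread_recur n y (x : G -> R) : thread B n y -> eigenfun lambda x ->
  recur lambda (x \o y) n.
Proof.
move=> ty ex i hi; have [us sa sd] := thread_adj degB ty hi.
have := eigenfun_deg (y i) ex; rewrite (nsum_nbrs _ us sa sd) -sd.
by rewrite !big_cons big_nil /= => E; lra.
Qed.

(** When [solU n = 0] the transfer over [n] steps is the scalar [e]: the last two values are [e]
    times those at indices 0 and -1. *)
Lemma thread_end n (Y : nat -> R) e : (1 < n)%N -> recur lambda Y n ->
  solU lambda n = 0 -> solU lambda n.-1 = - e ->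
  Y n = Y 0%N * e /\ Y n.-1 = ((2 - lambda) * Y 0%N - Y 1%N) * e.
Proof.
case: n => [|[|n]] // _ rY Un Un1; have := solSS lambda 0 1 n.
rewrite -/(solU lambda) Un [X in _ * X - _]Un1 => Un2.
rewrite (recurE rY (leqnn _)) (recurE rY (leqnSn _)) !solE Un Un1.
have -> : solU lambda n = - ((2 - lambda) * e) by lra.
by split; ring.
Qed.

(** Multiplicity 3 would make all three transfers the same nonzero scalar [e]. The equation at [z'],
    compared with the one at [z], then gives [lambda * e = 0], while [solU na = 0] excludes lambda =
    0. *)
Lemma theta_mult z a b c z' a' b' c' : connected G ->
  uniq [:: a; b; c] -> all (adj z) [:: a; b; c] -> deg z = 3%N ->
  uniq [:: a'; b'; c'] -> all (adj z') [:: a'; b'; c'] -> deg z' = 3%N ->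
  linked B (z, a) (z', a') -> linked B (z, b) (z', b') -> linked B (z, c) (z', c') ->
  mult G lambda <> 3%N.
Proof.
move=> [_ cG] us sa dz us' sa' dz' [na [ya [ta [ya0 ya1] [yan yan1]]]].
move=> [nb [yb [tb [yb0 yb1] [ybn ybn1]]]] [nc [yc [tc [yc0 yc1] [ycn ycn1]]]].
have eqz x : eigenfun lambda x -> x a + x b + x c = (3 - lambda) * x z.
  move=> ex; have := eigenfun_deg z ex; rewrite (nsum_nbrs _ us sa (esym dz)) dz.
  by rewrite !big_cons big_nil => E; lra.
have eqz' x : eigenfun lambda x -> x a' + x b' + x c' = (3 - lambda) * x z'.
  move=> ex; have := eigenfun_deg z' ex; rewrite (nsum_nbrs _ us' sa' (esym dz')) dz'.
  by rewrite !big_cons big_nil => E; lra.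
pose on n (y : nat -> G) v := exists2 i, (i <= n)%N & v = y i.
(* The three threads exhaust [G]: their union is closed under adjacency. *)
pose S v := [\/ on na ya v, on nb yb v | on nc yc v].
have closed_end v : v \in [:: z; a; b; c; z'; a'; b'; c'] -> S v.
  have [a0 _ _ _ _] := ta; have [b0 _ _ _ _] := tb; have [c0 _ _ _ _] := tc.
  rewrite !inE => /or4P[/eqP->|/eqP->|/eqP->|].
  - by constructor 1; exists 0%N.
  - by constructor 1; exists 1%N.
  - by constructor 2; exists 1%N.
  case/or4P=> [/eqP->|/eqP->|/eqP->|/orP[]/eqP->].
  - by constructor 3; exists 1%N.
  - by constructor 1; exists na.
  - by constructor 1; exists na.-1; rewrite ?leq_pred.
  - by constructor 2; exists nb.-1; rewrite ?leq_pred.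
  by constructor 3; exists nc.-1; rewrite ?leq_pred.
have closed_thread n y i w : thread B n y -> y 0%N = z -> y n = z' ->
    (i <= n)%N -> adj (y i) w -> S w \/ on n y w.
  move=> ty y0 yn iN; case: (posnP i) => [->|i0].
    rewrite y0 (adj_nbrs us sa) ?dz // => h; left; apply: closed_end.
    by move: h; rewrite !inE => /or3P[] ->; rewrite ?orbT.
  move: iN; rewrite leq_eqVlt => /orP[/eqP->|iN].
    rewrite yn (adj_nbrs us' sa') ?dz' // => h; left; apply: closed_end.
    by move: h; rewrite !inE => /or3P[] ->; rewrite ?orbT.
  have [u2 s2 d2] := thread_adj degB ty (introT andP (conj i0 iN)).
  rewrite (adj_nbrs u2 s2 d2) !inE => /orP[]/eqP->; right.
    by exists i.-1 => //; apply: leq_trans (leq_pred i) (ltnW iN).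
  by exists i.+1.
have closedS v w : S v -> adj v w -> S w.
  case=> -[i iN ->] vw.
  - by have [//|h] := closed_thread _ _ _ _ ta ya0 yan iN vw; constructor 1.
  - by have [//|h] := closed_thread _ _ _ _ tb yb0 ybn iN vw; constructor 2.
  - by have [//|h] := closed_thread _ _ _ _ tc yc0 ycn iN vw; constructor 3.
have allS v : S v.
  have /connectP[p pp ->] := cG z v; have : S z by apply: closed_end; rewrite mem_head.
  elim: p z pp {us sa dz ya0 yb0 yc0 eqz closed_end closed_thread} => //= t p IHp z0.
  by case/andP=> zt pt Sz; apply: IHp => //; exact: closedS zt.
have det : determining lambda [:: z; a; b].
  move=> x ex x0; have xz : x z = 0 by rewrite x0 ?mem_head.
  have xa : x a = 0 by rewrite x0 // !inE eqxx orbT.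
  have xb : x b = 0 by rewrite x0 // !inE eqxx !orbT.
  have xc : x c = 0 by have := eqz x ex; rewrite xz xa xb; lra.
  have zero n y : thread B n y -> x (y 0%N) = 0 -> x (y 1%N) = 0 ->
      forall i, (i <= n)%N -> x (y i) = 0.
    move=> ty y0 y1 i iN; have /= := recurE (thread_recur ty ex) iN.
    by rewrite y0 y1 sol0.
  move=> v; case: (allS v) => -[i iN ->].
  - by apply: (zero _ _ ta); rewrite ?ya0 ?ya1.
  - by apply: (zero _ _ tb); rewrite ?yb0 ?yb1.
  - by apply: (zero _ _ tc); rewrite ?yc0 ?yc1.
have [m1 _] := mult_realizing det => /m1 real.
have [//|X eX [Xz Xa Xb]] := real [:: 0; 1; 0].
have [//|X' eX' [Xz' Xa' Xb']] := real [:: 0; 0; 1].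
have [//|Y eY [Yz Ya Yb]] := real [:: 1; 0; 0].
have val n y x : thread B n y -> eigenfun lambda x -> y 0%N = z -> y n = z' ->
    x z' = x (y 1%N) * solU lambda n - x z * solU lambda n.-1.
  move=> ty ex y0 yn; have /= := recurE (thread_recur ty ex) (leqnn n).
  by have [n0 _ _ _ _] := ty; rewrite yn y0 -(prednK n0) solE.
(* A thread on which the function starts with 0, 0 shows that it vanishes at [z']; a thread starting
   with 0 and a nonzero value then gives [solU = 0] for its length. *)
have Xz'0 : X z' = 0 by rewrite (val _ _ _ tb eX) // yb1 Xz Xb; ring.
have X'z'0 : X' z' = 0 by rewrite (val _ _ _ ta eX') // ya1 Xz' Xa'; ring.
have Ua : solU lambda na = 0 by have := val _ _ _ ta eX ya0 yan; rewrite ya1 Xa Xz Xz'0; lra.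
have Ub : solU lambda nb = 0.
  by have := val _ _ _ tb eX' yb0 ybn; rewrite yb1 Xb' Xz' X'z'0; lra.
have Uc : solU lambda nc = 0.
  have Xc : X c = -1 by have := eqz X eX; rewrite Xz Xa Xb; lra.
  by have := val _ _ _ tc eX yc0 ycn; rewrite yc1 Xc Xz Xz'0; lra.
pose e := Y z'.
have Ue n y : thread B n y -> y 0%N = z -> y n = z' -> solU lambda n = 0 ->
    [/\ (1 < n)%N, solU lambda n.-1 = - e & Y (y n.-1) = ((2 - lambda) - Y (y 1%N)) * e].
  move=> ty y0 yn Un; have Ue : solU lambda n.-1 = - e.
    by have := val _ _ _ ty eY y0 yn; rewrite Un Yz -/e; lra.
  have n1 : (1 < n)%N.
    have [n0 _ _ _ _] := ty; case: (ltngtP 1%N n) => // n1; first by lia.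
    by move/eqP: Un; rewrite -n1 /= oner_eq0.
  split=> //; have [_ /= ->] := thread_end n1 (thread_recur ty eY) Un Ue.
  by rewrite y0 Yz mulr1.
have [na1 Uea Yea] := Ue _ _ ta ya0 yan Ua.
have [_ _ Yeb] := Ue _ _ tb yb0 ybn Ub.
have [_ _ Yec] := Ue _ _ tc yc0 ycn Uc.
have := eqz' Y eY; have := eqz Y eY; rewrite -yan1 -ybn1 -ycn1 Yea Yeb Yec ya1 yb1 yc1.
rewrite Ya Yb Yz -/e => Yc; have {Yc}-> : Y c = 3 - lambda by lra.
(* The three values next to [z'] add up to (3 (2 - lambda) - (3 - lambda)) e, which must equal (3 -
   lambda) e. *)
move=> E; have le : lambda * e = 0 by lra.
have e0 : e != 0.
  apply/eqP => e0; have := solU_wronskian lambda na.-2.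
  have -> : na.-2.+1 = na.-1 by lia.
  rewrite prednK ?(ltnW na1) // Ua Uea e0 => W; have : (0 : R) = 1 by rewrite -[RHS]W; ring.
  by move/eqP; rewrite eq_sym oner_eq0.
have := solU_eq0_lambda (ltnW na1) Ua.
by move/eqP: le; rewrite mulf_eq0 (negPf e0) orbF => ->.
Qed.

End Theta.
(** * Classification of the graphs *)

Lemma handshake (G : sgraph) : (\sum_(v : G) deg v = 2 * #|edges G|)%N.
Proof.
pose h (p : G * G) := [set p.1; p.2].
have -> : (\sum_(v : G) deg v = \sum_(p : G * G | adj p.1 p.2) 1)%N.
  by under eq_bigr => v _ do rewrite deg_nsum /nsum; rewrite pair_big_dep.
rewrite (partition_big_imset h) /= mulnC -sum_nat_const.
apply: eq_bigr => e /imsetP[[x y] xy ->]; have {}xy : adj x y := xy.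
rewrite sum1dep_card (_ : [set p | _] = [set (x, y); (y, x)]).
  rewrite cards2 xpair_eqE; have [xE|//] := eqVneq x y.
  by move: xy; rewrite xE adj_irr.
apply/setP => -[a b]; rewrite !inE /= !xpair_eqE; apply/andP/orP.
  move=> [ab /eqP/setP E]; have {}ab : adj a b := ab.
  have := E a; have := E b; rewrite !inE /= !eqxx orbT /=.
  move=> /esym/orP[]/eqP bE /esym/orP[]/eqP aE; rewrite aE bE !eqxx; try by [left|right].
    by move: ab; rewrite aE bE adj_irr.
  by move: ab; rewrite aE bE adj_irr.
case=> /andP[/eqP-> /eqP->]; split=> //; first exact: etrans (adj_sym _ _) xy.
by rewrite /h /= setUC.
Qed.

Section Classification.
Variable G : sgraph.
Hypothesis cG : connected G.

Lemma nbr_exists (x : G) (s : seq G) : (size s < deg x)%N ->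
  exists2 y, adj x y & y \notin s.
Proof.
move=> lt_s; have : ~~ ([set y | adj x y] \subset [set y in s]).
  apply: contraL lt_s => /subset_leq_card; rewrite -leqNgt => /leq_trans; apply.
  by rewrite cardsE card_size.
by case/subsetPn => y; rewrite !inE; exists y.
Qed.

Lemma connected_closed (S : pred G) z : S z ->
  (forall v w, S v -> adj v w -> S w) -> forall v, S v.
Proof.
move=> Sz closedS v; have [_ /(_ z v)/connectP[p pp ->]] := cG.
elim: p z pp Sz => //= t p IHp z /andP[zt pt] Sz.
by apply: IHp => //; exact: closedS zt.
Qed.

Lemma deg_gt0 (x y : G) : x != y -> (0 < deg x)%N.
Proof.
move=> xy; rewrite lt0n; apply/eqP => d0; move: xy.
have := @connected_closed (pred1 x) x (eqxx x) _ y; rewrite /= (eq_sym y x) => -> //.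
move=> v w /eqP-> xw; move/eqP: d0; rewrite cards_eq0 => /eqP/setP/(_ w).
by rewrite !inE xw.
Qed.

Lemma sum_nat_eq1P (P : pred G) (F : G -> nat) : (\sum_(v | P v) F v = 1)%N ->
  exists z, [/\ P z, F z = 1%N & forall v, P v -> v != z -> F v = 0%N].
Proof.
move=> F1; have [z /andP[Pz Fz]] : exists z, P z && (F z != 0%N).
  apply/existsP; apply: contra_eqT F1; rewrite negb_exists => /forallP F0.
  by rewrite big1 // => v Pv; have := F0 v; rewrite Pv /= negbK => /eqP.
move: F1; rewrite (bigD1 z) //= => F1; exists z; split=> //; first by lia.
move=> v Pv vz; have : (\sum_(i | P i && (i != z)) F i == 0)%N by lia.
by rewrite sum_nat_eq0 => /forallP/(_ v); rewrite Pv vz => /eqP.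
Qed.

Lemma sum_nat_eq0P (P : pred G) (F : G -> nat) : (\sum_(v | P v) F v = 0)%N ->
  forall v, P v -> F v = 0%N.
Proof.
by move/eqP; rewrite sum_nat_eq0 => /forallP F0 v Pv; have := F0 v; rewrite Pv => /eqP.
Qed.

Section NoPendant.
Hypothesis sumdeg : (\sum_(v : G) deg v = 2 * #|G| + 2)%N.
Hypothesis deg_ge2 : forall v : G, (2 <= deg v)%N.

(** Hence one vertex of degree 4 or two of degree 3, and degree 2 elsewhere. *)
Let excess : (\sum_(v : G) (deg v - 2) = 2)%N.
Proof.
have : (\sum_(v : G) (deg v - 2) + \sum_(v : G) 2 = 2 * #|G| + 2)%N.
  by rewrite -big_split -sumdeg /=; apply: eq_bigr => v _; rewrite subnK.
rewrite sum_nat_const; have -> : #|[pred _ : G | true]| = #|G| by apply: eq_card.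
lia.
Qed.

(** The four darts at [z] can only be paired with each other, which makes two loops at [z]. *)
Lemma infinity_iso (z : G) : deg z = 4%N -> (forall v : G, v != z -> deg v = 2%N) ->
  exists g1 g2 (u : cycle_graph g1) (w : cycle_graph g2),
    [/\ (3 <= g1)%N, (3 <= g2)%N & isomorphic G (path_join u w 1)].
Proof.
move=> d4 d2; pose B := pred1 z; have Bz : B z by exact: eqxx.
have degB v : ~~ B v -> deg v = 2%N by exact: d2.
have [|a za _] := @nbr_exists z [::]; first by rewrite d4.
have [[z1 a'] [/= /eqP z1E za' la]] := linked_exists degB Bz za.
rewrite {z1}z1E in za' la.
have aa' : a != a' by apply/eqP => E; apply: (linked_irr degB (d := (z, a))); rewrite {2}E.
have [|b zb] := @nbr_exists z [:: a; a']; first by rewrite d4.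
rewrite !inE negb_or => /andP[ba ba'].
have [[z1 b'] [/= /eqP z1E zb' lb]] := linked_exists degB Bz zb.
rewrite {z1}z1E in zb' lb.
have bb' : b != b' by apply/eqP => E; apply: (linked_irr degB (d := (z, b))); rewrite {2}E.
have ab' : a != b'.
  apply/eqP => E; rewrite -E in lb.
  have [] := linked_fun degB la (linked_sym lb) => E'.
  by rewrite E' eqxx in ba'.
have a'b' : a' != b'.
  apply/eqP => E; rewrite -E in lb.
  have [] := linked_fun degB (linked_sym la) (linked_sym lb) => E'.
  by rewrite E' eqxx in ba.
have us : uniq [:: a; a'; b; b'].
  by rewrite /= !inE !negb_or aa' ab' a'b' bb' [a == b]eq_sym ba [a' == b]eq_sym ba'.
have zE := adj_count us _ (esym d4); rewrite /= za za' zb zb' in zE.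
have {}zE := zE isT.
have [g1 [u [f [g13 [fu cf Bf sf]]]]] := loop_cycle degB la.
have [g2 [w [h [g23 [hw ch Bh sh]]]]] := loop_cycle degB lb.
exists g1, g2, u, w; split=> //.
apply: (@path_join_iso _ _ _ u w 0 f (fun=> z) h) => //.
- by move=> i x /andP[].
- by move=> _ x; rewrite sf sh zE addn0 -!addnA.
- by move=> i /andP[].
Qed.

(** A loop at [z] uses two of its three darts; the third leads to [z'], whose other two darts must
    then form a loop. Without a loop at [z], all three darts lead to [z'] and [G] is a theta
    graph. *)
Lemma two_cubic (z z' : G) : z != z' -> deg z = 3%N -> deg z' = 3%N ->
    (forall v : G, v != z -> v != z' -> deg v = 2%N) ->
  (exists g1 g2 (u : cycle_graph g1) (w : cycle_graph g2) n,
    [/\ (3 <= g1)%N, (3 <= g2)%N & isomorphic G (path_join u w n.+1)]) \/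
  forall (R : realType) (lambda : R), mult G lambda <> 3%N.
Proof.
move=> zz' d3 d3' d2; pose B v := (v == z) || (v == z').
have Bz : B z by rewrite /B eqxx.
have Bz' : B z' by rewrite /B eqxx orbT.
have degB v : ~~ B v -> deg v = 2%N by rewrite negb_or => /andP[]; exact: d2.
have irr v a : ~ linked B (v, a) (v, a) := @linked_irr _ _ degB (v, a).
have fn := linked_fun degB; have sym := @linked_sym G B.
have [[a [b [za zb lab]]]|noloop] :
    (exists a b, [/\ adj z a, adj z b & linked B (z, a) (z, b)]) \/
    (forall a, adj z a -> exists2 a', adj z' a' & linked B (z, a) (z', a')).
  have [|a za _] := @nbr_exists z [::]; first by rewrite d3.
  have [|b zb] := @nbr_exists z [:: a]; first by rewrite d3.
  rewrite inE => ba.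
  have [|c zc] := @nbr_exists z [:: a; b]; first by rewrite d3.
  rewrite !inE negb_or => /andP[ca cb].
  have us : uniq [:: a; b; c].
    by rewrite /= !inE !negb_or eq_sym ba [a == c]eq_sym ca [b == c]eq_sym cb.
  have zE := adj_nbrs us _ (esym d3); rewrite /= za zb zc in zE.
  have {}zE := zE isT.
  have step x : adj z x -> (exists y, adj z y /\ linked B (z, x) (z, y)) \/
      exists2 x', adj z' x' & linked B (z, x) (z', x').
    move=> zx; have [[t y] [/= /orP[]/eqP-> zy lxy]] := linked_exists degB Bz zx.
      by left; exists y.
    by right; exists y.
  case: (step a za) => [[y [zy l]]|la]; first by left; exists a, y.
  case: (step b zb) => [[y [zy l]]|lb]; first by left; exists b, y.
  case: (step c zc) => [[y [zy l]]|lc]; first by left; exists c, y.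
  by right=> x; rewrite zE !inE => /or3P[]/eqP->.
- left; have ab : a != b by apply/eqP => E; apply: (irr z a); rewrite {2}E.
  have [|c zc] := @nbr_exists z [:: a; b]; first by rewrite d3.
  rewrite !inE negb_or => /andP[ca cb].
  have us : uniq [:: a; b; c].
    by rewrite /= !inE !negb_or ab [a == c]eq_sym ca [b == c]eq_sym cb.
  have zN := adj_nbrs us _ (esym d3); rewrite /= za zb zc in zN.
  have {}zN := zN isT.
  have zE := adj_count us _ (esym d3); rewrite /= za zb zc in zE.
  have {}zE := zE isT.
  have [[t c'] [/= Bt tc' lc]] := linked_exists degB Bz zc.
  case/orP: Bt => /eqP tE; rewrite {t}tE in tc' lc.
    move: tc'; rewrite zN !inE => /or3P[]/eqP E; rewrite {}E in lc.
    - by have [] := fn _ _ _ lab (sym _ _ lc) => E; rewrite E eqxx in cb.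
    - by have [] := fn _ _ _ (sym _ _ lab) (sym _ _ lc) => E; rewrite E eqxx in ca.
    by have := irr z c lc.
  have [|a' za'] := @nbr_exists z' [:: c']; first by rewrite d3'.
  rewrite inE => ac'.
  have [[t b'] [/= Bt tb' la']] := linked_exists degB Bz' za'.
  case/orP: Bt => /eqP tE; rewrite {t}tE in tb' la'.
    move: tb'; rewrite zN !inE => /or3P[]/eqP E; rewrite {}E in la'.
    - have [E _] := fn _ _ _ lab (sym _ _ la').
      by rewrite E eqxx in zz'.
    - have [E _] := fn _ _ _ (sym _ _ lab) (sym _ _ la').
      by rewrite E eqxx in zz'.
    have [E] := fn _ _ _ lc (sym _ _ la').
    by rewrite E eqxx in ac'.
  have ab' : a' != b' by apply/eqP => E; apply: (irr z' a'); rewrite {2}E.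
  have bc' : b' != c'.
    apply/eqP => E; rewrite {}E in la'.
    have [E _] := fn _ _ _ (sym _ _ lc) (sym _ _ la').
    by rewrite E eqxx in zz'.
  have us' : uniq [:: a'; b'; c'] by rewrite /= !inE !negb_or ab' ac' bc'.
  have zE' := adj_count us' _ (esym d3'); rewrite /= za' tb' tc' in zE'.
  have {}zE' := zE' isT.
  have [g1 [u [f [g13 [fu cf Bf sf]]]]] := loop_cycle degB lab.
  have [g2 [w [h [g23 [hw ch Bh sh]]]]] := loop_cycle degB la'.
  have [n [y [ty [y0 y1] [yn yn1]]]] := lc.
  have [n0 _ nB ay _] := ty.
  exists g1, g2, u, w, n; split=> //.
  apply: (@path_join_iso _ _ _ u w n f y h); rewrite ?y0 ?y1 ?yn ?yn1 //.
  - move=> i x hi; have [u2 s2 e2] := thread_adj degB ty hi.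
    by rewrite (adj_count u2 s2 e2) /= addn0.
  - by move=> E; rewrite E in n0.
  - by move=> _ x; rewrite sf zE addn0 -!addnA.
  - by move=> _ x; rewrite sh zE' addn0 -!addnA.
  - by move=> x xu; apply: contraNneq (Bf x xu) => ->.
  - by move=> i hi; apply: contraNneq (nB i hi) => ->.
  - by move=> x xw; apply: contraNneq (Bh x xw) => ->.
  - by move=> _; rewrite eq_sym.
right=> R lambda.
have [|a za _] := @nbr_exists z [::]; first by rewrite d3.
have [|b zb] := @nbr_exists z [:: a]; first by rewrite d3.
rewrite inE => ba.
have [|c zc] := @nbr_exists z [:: a; b]; first by rewrite d3.
rewrite !inE negb_or => /andP[ca cb].
have [a' za' la] := noloop a za; have [b' zb' lb] := noloop b zb.
have [c' zc' lc] := noloop c zc.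
have diff x x' y y' : x != y -> linked B (z, x) (z', x') -> linked B (z, y) (z', y') ->
    x' != y'.
  move=> xy lx ly; apply/eqP => E; rewrite {}E in lx.
  by have [E] := fn _ _ _ (sym _ _ lx) (sym _ _ ly); rewrite E eqxx in xy.
apply: (@theta_mult R G B degB lambda z a b c z' a' b' c') => //=.
- by rewrite !inE !negb_or eq_sym ba [a == c]eq_sym ca [b == c]eq_sym cb.
- by rewrite za zb zc.
- rewrite !inE !negb_or (diff _ _ _ _ _ la lb) ?(diff _ _ _ _ _ la lc) //.
  + by rewrite (diff _ _ _ _ _ lb lc) // eq_sym.
  + by rewrite eq_sym.
  by rewrite eq_sym.
- by rewrite za' zb' zc'.
Qed.

Lemma no_pendant_cases :
  (exists g1 g2 (u : cycle_graph g1) (w : cycle_graph g2) n,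
    [/\ (3 <= g1)%N, (3 <= g2)%N & isomorphic G (path_join u w n.+1)]) \/
  forall (R : realType) (lambda : R), mult G lambda <> 3%N.
Proof.
have [z dz] : exists z : G, deg z != 2%N.
  apply/existsP; apply: contra_eqT excess; rewrite negb_exists => /forallP d2.
  by rewrite big1 // => v _; have := d2 v; rewrite negbK => /eqP->.
have dz2 := deg_ge2 z; move: excess; rewrite (bigD1 z) //= => S.
have [d3|d4] : deg z = 3%N \/ deg z = 4%N by lia.
  have [|z' [zz' d3' d2]] := @sum_nat_eq1P (fun v => v != z) (fun v => deg v - 2)%N.
    by lia.
  have dz' := deg_ge2 z'.
  apply: (@two_cubic z z'); rewrite 1?eq_sym //; first by lia.
  by move=> v vz vz'; have := d2 v vz vz'; have := deg_ge2 v; lia.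
left; have [|g1 [g2 [u [w [g13 g23 iso]]]]] := @infinity_iso z d4.
  move=> v vz; have dv := deg_ge2 v.
  suff : (deg v - 2 = 0)%N by lia.
  by apply: (@sum_nat_eq0P (fun v => v != z) (fun v => deg v - 2)%N) => //; lia.
by exists g1, g2, u, w, 0%N.
Qed.

End NoPendant.

Section OneQuasiPendant.
Variable w : G.
Hypothesis pendant_adj : forall p x : G, pendant p -> adj p x -> x = w.
Hypothesis sumdeg : (\sum_(v : G) deg v = 2 * #|G|)%N.
Hypothesis w_pendant : exists2 p : G, pendant p & adj w p.

Let wN : ~~ pendant w.
Proof.
by have [p pp wp] := w_pendant; apply/negP => /pendant_adj/(_ wp) E; rewrite E adj_irr in wp.
Qed.

Let P : {set G} := [set v | pendant v].

Let adjwP (p : G) : pendant p -> adj p w.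
Proof.
move=> pp; have [|x px _] := @nbr_exists p [::]; first by rewrite (eqP pp).
by rewrite -(pendant_adj pp px).
Qed.

Let neq_pendant (v : G) : ~~ pendant v -> forall p, pendant p -> v != p.
Proof. by move=> nv p pp; apply: contraNneq nv => ->. Qed.

Let deg_pos (v : G) : (0 < deg v)%N.
Proof.
have [p pp wp] := w_pendant; have [->|vw] := eqVneq v w.
  exact: deg_gt0 (neq_pendant wN pp).
exact: deg_gt0 vw.
Qed.

Let N : {set G} := [set v | adj w v && ~~ pendant v].

Let deg_w : (deg w = #|P| + #|N|)%N.
Proof.
rewrite /deg -(cardsID P); congr (_ + _)%N; apply: eq_card => v.
  by rewrite !inE; have [/adjwP|_] := boolP (pendant v); rewrite ?andbF // adj_sym => ->.
by rewrite !inE andbC.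
Qed.

(** The degrees average 2 and truncated subtraction raises -1 to 0 at each pendant vertex, so the
    differences sum to [#|P|]; the vertex [w] accounts for [#|P| + #|N| - 2] of this. *)
Let excess : (\sum_(v | v != w) (deg v - 2) + #|N| = 2)%N.
Proof.
have : (\sum_(v : G) (deg v - 2) = #|P|)%N.
  have : (\sum_(v : G) (deg v - 2) + \sum_(v : G) 2 = \sum_(v : G) deg v + #|P|)%N.
    have -> : #|P| = (\sum_(v : G) pendant v)%N.
      by rewrite -sum1_card big_mkcond; apply: eq_bigr => v _; rewrite inE; case: pendant.
    rewrite -!big_split /=; apply: eq_bigr => v _.
    by rewrite /pendant; have := deg_pos v; case: eqP; lia.
  rewrite sum_nat_const sumdeg; have -> : #|[pred _ : G | true]| = #|G| by apply: eq_card.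
  lia.
rewrite (bigD1 w) //= deg_w; have := deg_pos w; move: wN; rewrite /pendant deg_w; lia.
Qed.

Let adjw (s : seq G) : uniq s -> s =i N ->
  forall x, (adj w x : nat) = ((x \in P) + count_mem x s)%N.
Proof.
move=> us sN x; rewrite count_uniq_mem // sN !inE.
by have [/adjwP|_] := boolP (pendant x); rewrite ?andbF ?andbT // adj_sym => ->.
Qed.

Let star_map (i : star_graph #|P|) : G := if i is Some j then enum_val j else w.

Let star_map_pendant (j : 'I_#|P|) : pendant (star_map (Some j)).
Proof. by have := enum_valP j; rewrite inE. Qed.

Let star_map_covers b : b != star_center #|P| -> covers_at star_map b.
Proof.
case: b => // j _ x; rewrite nsum_star_leaf /=.
have pj := star_map_pendant j; have pw := adjwP pj.
have := @adj_count _ (enum_val j) [:: w] isT _ _ x; rewrite /= pw (eqP pj).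
by move=> /(_ isT erefl) ->; rewrite addn0.
Qed.

Let star_map_center x :
  nsum (star_center #|P|) (fun y => (star_map y == x) : nat) = (x \in P).
Proof.
rewrite nsum_star_center /=; have [xP|xP] := boolP (x \in P).
  rewrite (bigD1 (enum_rank_in xP x)) //= enum_rankK_in // eqxx big1 // => i.
  move=> ix; case: eqP => // E; move: ix.
  by rewrite -(inj_eq enum_val_inj) enum_rankK_in // E eqxx.
by rewrite big1 // => i _; case: eqP => // E; rewrite -E enum_valP in xP.
Qed.

Section Link.
Variable B : pred G.
Hypothesis degB : forall v, ~~ B v -> deg v = 2%N.
Hypotheses (Bw : B w) (BP : forall p : G, pendant p -> B p).

Let link_pendant (p : G) : pendant p -> linked B (p, w) (w, p).
Proof.
move=> pp; exists 1%N, (fun i => if i is 0%N then p else w); split=> //; split=> //=.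
- by split=> //; exact: BP.
- by case.
by case=> // _; exact: adjwP.
Qed.

(** Each pendant edge at [w] is a thread of length 1, so its two darts are linked to each other and
    to nothing else. *)
Lemma link_nonpendant v a e : linked B (v, a) e -> adj e.1 e.2 ->
  ~~ pendant v -> (v = w -> ~~ pendant a) -> ~~ pendant e.1 /\ (e.1 = w -> ~~ pendant e.2).
Proof.
have fn := linked_fun degB; have sym := @linked_sym G B.
case: e => t x /= l tx vN aN.
have ntP (p : G) : pendant p -> (v, a) <> (p, w).
  by move=> pp [vp _]; rewrite vp pp in vN.
have nwP (p : G) : pendant p -> (v, a) <> (w, p).
  by move=> pp [vw ap]; move: (aN vw); rewrite ap pp.
split.
  apply/negP => pt; have xw := pendant_adj pt tx; rewrite {}xw in l.
  exact: (nwP _ pt (fn _ _ _ (sym _ _ l) (link_pendant pt))).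
move=> tw; rewrite {}tw in l; apply/negP => px.
exact: (ntP _ px (fn _ _ _ (sym _ _ l) (sym _ _ (link_pendant px)))).
Qed.

End Link.

Let k_gt0 : (0 < #|P|)%N.
Proof. by have [p pp _] := w_pendant; apply/card_gt0P; exists p; rewrite inE. Qed.

(** By [excess], [w] is the only branching vertex, so its two darts into [N] are linked and [w] lies
    on the cycle. *)
Lemma star_on_cycle_iso : #|N| = 2%N ->
  exists g (u : cycle_graph g), (3 <= g)%N /\
    isomorphic G (path_join u (star_center #|P|) 1).
Proof.
move=> N2; pose B (v : G) := (v == w) || pendant v.
have Bw : B w by rewrite /B eqxx.
have BP (p : G) : pendant p -> B p by rewrite /B orbC => ->.
have degB v : ~~ B v -> deg v = 2%N.
  rewrite negb_or /pendant => /andP[vw d1].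
  have S0 : (\sum_(v | v != w) (deg v - 2) = 0)%N by move: excess; rewrite N2; lia.
  by have := sum_nat_eq0P S0 vw; have := deg_pos v; lia.
have [a aN] : exists a, a \in N by apply/card_gt0P; rewrite N2.
have /andP[wa na] : adj w a && ~~ pendant a by rewrite inE in aN.
have [[t a'] [/= Bt ta' la]] := linked_exists degB Bw wa.
have [/= nt na'] := link_nonpendant degB Bw BP la ta' wN (fun _ => na).
case/orP: Bt => [/eqP tw|pt]; last by rewrite pt in nt.
rewrite {t}tw in ta' la nt na'.
have aa' : a != a' by apply/eqP => E; apply: (linked_irr degB (d := (w, a))); rewrite {2}E.
have us : uniq [:: a; a'] by rewrite /= inE aa'.
have sN : [:: a; a'] =i N.
  have /eqP E : [set a; a'] == N.
    rewrite eqEcard cards2 aa' N2 andbT; apply/subsetP => v; rewrite !inE.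
    by case/orP=> /eqP->; rewrite ?wa // ta' na'.
  by move=> v; rewrite -E !inE.
have wE := adjw us sN; rewrite /= in wE.
have [g [u [f [g3 [fu cf Bf sf]]]]] := loop_cycle degB la.
exists g, u; split=> //.
apply: (@path_join_iso _ _ _ u (star_center #|P|) 0 f (fun=> w) star_map) => //.
- by move=> i x /andP[].
- by move=> _ x; rewrite sf star_map_center wE addn0 addnC.
- by move=> x xu; apply: contraNneq (Bf x xu) => ->.
- by move=> i /andP[].
by case=> // j _; rewrite eq_sym neq_pendant // star_map_pendant.
Qed.

(** By [excess] there is one vertex [u] of degree 3 besides [w]. The only dart from [w] into [N]
    cannot return to [w], so it leads to [u], and the other two darts of [u] form a loop. *)
Lemma star_off_cycle_iso : #|N| = 1%N ->
  exists g (u : cycle_graph g) n, (3 <= g)%N /\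
    isomorphic G (path_join u (star_center #|P|) n.+1).
Proof.
move=> N1; have [|u [uw du dv]] := @sum_nat_eq1P (fun v => v != w) (fun v => deg v - 2)%N.
  by move: excess; rewrite N1; lia.
have {}du : deg u = 3%N by lia.
have uN : ~~ pendant u by rewrite /pendant du.
pose B v := [|| v == w, v == u | pendant v].
have Bw : B w by rewrite /B eqxx.
have Bu : B u by rewrite /B eqxx orbT.
have BP (p : G) : pendant p -> B p by rewrite /B => ->; rewrite !orbT.
have degB v : ~~ B v -> deg v = 2%N.
  rewrite !negb_or /pendant => /and3P[vw vu d1].
  by have := dv v vw vu; have := deg_pos v; lia.
have irr v a : ~ linked B (v, a) (v, a) := @linked_irr _ _ degB (v, a).
have fn := linked_fun degB; have sym := @linked_sym G B.
have /cards1P[a NE] : #|N| == 1%N by rewrite N1.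
have /andP[wa na] : adj w a && ~~ pendant a.
  by have := set11 a; rewrite -NE inE.
have aE (v : G) : adj w v -> ~~ pendant v -> v = a.
  by move=> wv nv; apply/set1P; rewrite -NE inE wv.
have [[t c] [/= Bt tc la]] := linked_exists degB Bw wa.
have [/= nt nc] := link_nonpendant degB Bw BP la tc wN (fun _ => na).
case/or3P: Bt => [/eqP tw|/eqP tu|pt]; last by rewrite pt in nt.
  rewrite {}tw in tc la nc; have ca := aE c tc (nc erefl).
  by rewrite ca in la; case: (irr w a).
rewrite {t nt nc}tu in tc la.
have [|b ub] := @nbr_exists u [:: c]; first by rewrite du.
rewrite inE => bc.
have [[t b'] [/= Bt tb' lb]] := linked_exists degB Bu ub.
have uw' : u = w -> ~~ pendant b by move=> E; rewrite E eqxx in uw.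
have [/= nt nb'] := link_nonpendant degB Bw BP lb tb' uN uw'.
case/or3P: Bt => [/eqP tw|/eqP tu|pt]; last by rewrite pt in nt.
  rewrite {}tw in tb' lb nb'; have b'a := aE b' tb' (nb' erefl).
  rewrite b'a in lb; have [E] := fn _ _ _ la (sym _ _ lb).
  by rewrite E eqxx in bc.
rewrite {t nt nb'}tu in tb' lb.
have bb' : b != b' by apply/eqP => E; apply: (irr u b); rewrite {2}E.
have b'c : b' != c.
  apply/eqP => E; rewrite E in lb; have [E' _] := fn _ _ _ (sym _ _ la) (sym _ _ lb).
  by rewrite E' eqxx in uw.
have us : uniq [:: b; b'; c] by rewrite /= !inE !negb_or bb' bc b'c.
have uE := adj_count us _ (esym du); rewrite /= ub tb' tc in uE.
have {}uE := uE isT.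
have wE := @adjw [:: a] isT; rewrite /= in wE.
have {}wE := wE (fun v => (_ : (v \in [:: a]) = (v \in N))).
have {}wE x : (adj w x : nat) = ((x \in P) + (a == x))%N.
  by rewrite wE ?addn0 // => v; rewrite NE !inE.
have [g [u0 [f [g3 [fu cf Bf sf]]]]] := loop_cycle degB lb.
(* The thread is reversed so that it starts on the cycle. *)
have [n [y [ty [y0 y1] [yn yn1]]]] := sym _ _ la.
have [n0 _ nB ay _] := ty.
exists g, u0, n; split=> //.
apply: (@path_join_iso _ _ _ u0 (star_center #|P|) n f y star_map);
  rewrite ?y0 ?y1 ?yn ?yn1 //.
- move=> i x hi; have [u2 s2 e2] := thread_adj degB ty hi.
  by rewrite (adj_count u2 s2 e2) /= addn0.
- by move=> E; rewrite E in n0.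
- by move=> _ x; rewrite sf uE addn0 -!addnA.
- by move=> _ x; rewrite star_map_center wE.
- by move=> x xu; apply: contraNneq (Bf x xu) => ->.
- by move=> i hi; apply: contraNneq (nB i hi) => ->.
- by case=> // j _; rewrite eq_sym neq_pendant // star_map_pendant.
by move=> _; rewrite eq_sym.
Qed.

Lemma one_quasi_pendant_iso :
  exists g (u : cycle_graph g) k n, [/\ (3 <= g)%N, (1 <= k)%N &
    isomorphic G (path_join u (star_center k) n.+1)].
Proof.
have N0 : #|N| != 0%N.
  (* With [N] empty [G] would be a star, whose vertices other than [w] have no excess. *)
  apply/eqP => N0; have allS := @connected_closed (fun v => (v == w) || pendant v) w.
  have {}allS v : (v == w) || pendant v.
    apply: allS => [|{v} v x]; first by rewrite eqxx.
    case/orP=> [/eqP->|pv] wx; last by rewrite (pendant_adj pv wx) eqxx.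
    apply/orP; right; apply/negPn/negP => nx.
    by move/eqP: N0; rewrite cards_eq0 => /eqP/setP/(_ x); rewrite !inE wx nx.
  move: excess; rewrite N0 big1 // => v vw.
  by have := allS v; rewrite (negPf vw) /= => /eqP->.
have [N1|N2] : #|N| = 1%N \/ #|N| = 2%N by move: excess; lia.
  have [g [u [n [g3 iso]]]] := star_off_cycle_iso N1.
  by exists g, u, #|P|, n.
have [g [u [g3 iso]]] := star_on_cycle_iso N2.
by exists g, u, #|P|, 0%N.
Qed.

End OneQuasiPendant.
End Classification.

(** * Pendant vertices of the model graphs, and the equivalence *)

Lemma quasi_pendant_exists (G : sgraph) :
  (0 < num_quasi_pendant G)%N <-> exists p : G, pendant p.
Proof.
split=> [/card_gt0P[x]|[p pp]].
  by rewrite inE => /existsP[p /andP[_ pp]]; exists p.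
have [|x px _] := @nbr_exists G p [::]; first by rewrite (eqP pp).
by apply/card_gt0P; exists x; rewrite inE; apply/existsP; exists p; rewrite adj_sym px.
Qed.

Lemma cycle_star_pendant g (u : cycle_graph g) k n : (0 < k)%N ->
  exists p : path_join u (star_center k) n.+1, pendant p.
Proof.
move=> k0; exists (pjB u (star_center k) n (Some (Ordinal k0))).
by rewrite /pendant deg_nsum nsum_pjB // nsum_star_leaf.
Qed.

Lemma cycle_cycle_no_pendant g (u : cycle_graph g) g' (w : cycle_graph g') n :
  (3 <= g)%N -> (3 <= g')%N -> ~ exists p : path_join u w n.+1, pendant p.
Proof.
move=> g3 g3' [p]; rewrite /pendant deg_nsum.
have [[a ->]|[i hi ->]|[b ->]] := path_joinP p.
- have [->|au] := eqVneq a u; last by rewrite nsum_pjA // nsum_cycle.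
  case: (posnP n) => n0; first by rewrite nsum_pj_ends0 // !nsum_cycle.
  by rewrite nsum_pj_left // nsum_cycle.
- by rewrite nsum_pjP.
have [->|bw] := eqVneq b w; last by rewrite nsum_pjB // nsum_cycle.
case: (posnP n) => n0; last by rewrite nsum_pj_right // nsum_cycle.
rewrite pjB_root (_ : pjP _ _ _ n = pjP _ _ _ 0); last by congr (pjP _ _ _ _).
by rewrite -pjA_root nsum_pj_ends0 // !nsum_cycle.
Qed.

Theorem theorem2p1 (R : realType) (G : sgraph) (lambda : R)
    (G_connected : connected G)
    (cq2 : cyclomatic G + (num_quasi_pendant G)%:Z = 2)
    (c_ge1 : 1 <= cyclomatic G)
    (lambda_neq1 : lambda <> 1) :
  optimal G lambda <->
  (exists (g : nat) (u : cycle_graph g) (k l : nat),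
      [/\ (3 <= g)%N, (1 <= k)%N & (1 < l)%N] /\
      [/\ isomorphic G (path_join u (star_center k) l),
          mult (cycle_graph g) lambda = 2%N
        & mult (star_path_tree k (l - 1)) lambda = 1%N])
  \/
  (exists (g1 g2 : nat) (u : cycle_graph g1) (w : cycle_graph g2) (l : nat),
      [/\ (3 <= g1)%N, (3 <= g2)%N & (1 < l)%N] /\
      [/\ isomorphic G (path_join u w l),
          mult (cycle_graph g1) lambda = 2%N,
          mult (cycle_graph g2) lambda = 2%N
        & (2 < l)%N -> mult (path_graph (l - 2)) lambda = 1%N]).
Proof.
have l1 : lambda != 1 by apply/eqP.
(* Substituting c = 2 - q turns 2c + q - 1 into 3 - q. *)
have optE : optimal G lambda <-> (mult G lambda + num_quasi_pendant G = 3)%N.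
  by rewrite /optimal; move: cq2; split; lia.
have card_edges : (#|edges G| + num_quasi_pendant G = #|G| + 1)%N.
  by move: cq2; rewrite /cyclomatic; lia.
have hs := handshake G.
have q1 : (num_quasi_pendant G <= 1)%N by lia.
have star_case g (u : cycle_graph g) k n : (3 <= g)%N -> (1 <= k)%N ->
    isomorphic G (path_join u (star_center k) n.+1) ->
    mult G lambda = 2%N <-> [/\ (1 < n.+1)%N, mult (cycle_graph g) lambda = 2%N
      & mult (star_path_tree k (n.+1 - 1)) lambda = 1%N].
  move=> g3 k1 iso; rewrite (mult_iso lambda iso) (mult_cycle_star n g3 u l1 k1).
  have mC := mult_cycle lambda g3 u; rewrite subn1 /=; case: n {iso} => [|n].
    by split=> [[]|[]].
  have mT := mult_star_path_tree k l1 n.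
  by split=> [[_ /mC ? /mT ?]|[_ /mC ? /mT ?]].
have cycle_case g1 g2 (u : cycle_graph g1) (w : cycle_graph g2) n :
    (3 <= g1)%N -> (3 <= g2)%N -> isomorphic G (path_join u w n.+1) ->
    mult G lambda = 3%N <-> [/\ (1 < n.+1)%N, mult (cycle_graph g1) lambda = 2%N,
      mult (cycle_graph g2) lambda = 2%N
      & (2 < n.+1)%N -> mult (path_graph (n.+1 - 2)) lambda = 1%N].
  move=> g3 g3' iso; rewrite (mult_iso lambda iso) (mult_cycle_cycle lambda n g3 u g3' w).
  have mC := mult_cycle lambda g3 u; have mC' := mult_cycle lambda g3' w.
  case: n {iso} => [|[|n]]; first by split=> [[]|[]].
    (* For l = 2 the path condition reads [sol 1 1 1 = sol 1 1 0], which holds by computation. *)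
    by split=> [[_ /mC ? /mC' ?]|[_ /mC ? /mC' ?]].
  rewrite subSS subn1 /=; have mP := mult_path lambda n.
  split=> [[_ /mC ? /mC' ? E]|[_ /mC ? /mC' ? /(_ isT)/mP E]].
    by split=> // _; apply/mP; exact: esym.
  by split=> //; exact: esym.
(* Since q is at most 1, it is enough to know whether the model graph has a pendant vertex. *)
have star_q g (u : cycle_graph g) k n : (1 <= k)%N ->
    isomorphic G (path_join u (star_center k) n.+1) -> num_quasi_pendant G = 1%N.
  move=> k1 iso; suff : (0 < num_quasi_pendant G)%N by lia.
  by apply/quasi_pendant_exists/(isomorphic_pendant iso)/cycle_star_pendant.
have cycle_q g1 g2 (u : cycle_graph g1) (w : cycle_graph g2) n :
    (3 <= g1)%N -> (3 <= g2)%N -> isomorphic G (path_join u w n.+1) ->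
    num_quasi_pendant G = 0%N.
  move=> g3 g3' iso; case: (posnP (num_quasi_pendant G)) => // /quasi_pendant_exists.
  by move/(isomorphic_pendant iso)/(cycle_cycle_no_pendant g3 g3').
rewrite optE; split; last first.
  case=> [[g [u [k [[|n] [[//]]]]]]|[g1 [g2 [u [w [[|n] [[//]]]]]]]].
    move=> g3 k1 n1 [iso mC mT]; rewrite (star_q _ _ _ _ k1 iso) addn1.
    by congr S; apply/(star_case _ _ _ _ g3 k1 iso).
  move=> g3 g3' n1 [iso mC mC' mP]; rewrite (cycle_q _ _ _ _ _ g3 g3' iso) addn0.
  exact/(cycle_case _ _ _ _ _ g3 g3' iso).
case: (posnP (num_quasi_pendant G)) => [q0|q_gt0] mG.
  have no_pendant (v : G) : ~~ pendant v.
    apply/negP => pv; suff : (0 < num_quasi_pendant G)%N by rewrite q0.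
    by apply/quasi_pendant_exists; exists v.
  have sumdeg : (\sum_(v : G) deg v = 2 * #|G| + 2)%N by lia.
  have deg_ge2 (v : G) : (2 <= deg v)%N.
    have := no_pendant v; rewrite /pendant; suff : deg v != 0%N by lia.
    have [y yv|allv] := pickP (fun y => y != v).
      by rewrite -lt0n; apply: (deg_gt0 G_connected (y := y)); rewrite eq_sym.
    (* If [v] is the only vertex, its degree is the whole degree sum, which is positive. *)
    have G0 : (0 < #|G|)%N by case: G_connected.
    move: sumdeg; rewrite (bigD1 v) //= big_pred0 // => E; apply/eqP => d0; lia.
  have [[g1 [g2 [u [w [n [g3 g3' iso]]]]]]|no3] :=
      no_pendant_cases G_connected sumdeg deg_ge2; last first.
    by case: (no3 R lambda); lia.
  right; exists g1, g2, u, w, n.+1.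
  have [|n1 ? ? ?] := iffLR (cycle_case _ _ _ _ _ g3 g3' iso); first by lia.
  by split.
have {}q1 : num_quasi_pendant G = 1%N by lia.
have [w wE] : exists w, [set x : G | quasi_pendant x] = [set w].
  by apply/cards1P/eqP.
have padj (p x : G) : pendant p -> adj p x -> x = w.
  move=> pp px; apply/set1P; rewrite -wE inE; apply/existsP; exists p.
  by rewrite adj_sym px.
have [p pp wp] : exists2 p : G, pendant p & adj w p.
  have : w \in [set x : G | quasi_pendant x] by rewrite wE set11.
  by rewrite inE => /existsP[p /andP[wp pp]]; exists p.
have sumdeg : (\sum_(v : G) deg v = 2 * #|G|)%N by lia.
have [g [u [k [n [g3 k1 iso]]]]] :=
  one_quasi_pendant_iso G_connected padj sumdeg (ex_intro2 _ _ p pp wp).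
left; exists g, u, k, n.+1.
have [|n1 ? ?] := iffLR (star_case _ _ _ _ g3 k1 iso); first by lia.
by split.
Qed.
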